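(* For every integer $i$ with $1\le i\le q^d-2$ one has $\Theta_\infty^{\#}(1,\widetilde\omega_{\mathfrak p}^i)\not\equiv0\pmod p$, i.e. $\Theta_\infty^{\#}(1,\widetilde\omega_{\mathfrak p}^i)\notin p\Lambda$.
   Context: Setting. $\mathbb F$ is a finite field with $q\ge 3$ elements and characteristic $p$. $A=\mathbb F[\theta]$, $F=\mathbb F(\theta)$, $\infty$ is the place of $F$ corresponding to $1/\theta$, $\mathfrak p$ is a nonzero prime ideal of $A$ of degree $d$, and $S=\{\mathfrak p,\infty\}$. $\Phi$ is the Carlitz module, i.e. the $\mathbb F$-algebra homomorphism $A\to F\{\tau\}$ with $\Phi_\theta=\theta\tau^0+\tau$ (where $\tau f=f^q\tau$), and $\Phi[\mathfrak a]$ is its $\mathfrak a$-torsion in an algebraic closure of $F$. Put $F_n=F(\Phi[\mathfrak p^{n+1}])$, $\mathcal F=\bigcup_n F_n$. Then $G_n=\mathrm{Gal}(F_n/F)\simeq (A/\mathfrak p^{n+1})^*$ is $\Delta\times\Gamma_n$, where $\Gamma_n=\mathrm{Gal}(F_n/F_0)$ is the $p$-Sylow subgroup and $\Delta\simeq\mathrm{Gal}(F_0/F)\simeq(A/\mathfrak p)^*$ is cyclic of order $q^d-1$. Put $\Gamma=\varprojlim\Gamma_n=\mathrm{Gal}(\mathcal F/F_0)$. $W$ is the Witt ring of $\mathbb F_{\mathfrak p}=A/\mathfrak p$ (so $W/pW=\mathbb F_{\mathfrak p}$) and $\Lambda=W[[\Gamma]]=\varprojlim W[\Gamma_n]$. $\widetilde\omega_{\mathfrak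 p}:\Delta\to W^*$ is the Teichmüller character: if $\sigma_a\in\Delta$ ($a\in A-\mathfrak p$) is the element acting on $\Phi[\mathfrak p]$ by $\varepsilon\mapsto\Phi_a(\varepsilon)$, then $\widetilde\omega_{\mathfrak p}(\sigma_a)$ is the $(q^d-1)$-th root of unity in $W$ whose reduction modulo $p$ is $a\bmod\mathfrak p$. Every character $\Delta\to W^*$ is a power $\widetilde\omega_{\mathfrak p}^i$; it is called even if $(q-1)\mid i$ and odd otherwise. Stickelberger series: $\Theta_n(X)=\prod_{\mathfrak q\notin S}(1-\mathrm{Fr}_{\mathfrak q}^{-1}X^{\deg\mathfrak q})^{-1}\in\mathbb Z[G_n][[X]]$ (product over places of $F$ outside $S$; $\mathrm{Fr}_{\mathfrak q}\in G_n$ the arithmetic Frobenius). For $\chi:\Delta\to W^*$, $\Theta_n(X,\chi)\in W[\Gamma_n][[X]]$ is its image under the map induced by $\delta\sigma\mapsto\chi(\delta)\sigma$ ($\delta\in\Delta$, $\sigma\in\Gamma_n$); for nontrivial $\chi$ it is a polynomial in $X$. Put $\Theta_n^{\#}(X,\chi)=\Theta_n(X,\chi)$ if $\chi$ is odd and $\Theta_n^{\#}(X,\chi)=\Theta_n(X,\chi)/(1-X)$ (again a polynomial over $W[\Gamma_n]$) if $\chi$ is even and nontrivial. Finally $\Theta_\infty^{\#}(1,\chi)=\varprojlim_n\Theta_n^{\#}(1,\chi)\in\Lambda$. *)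

(* Defs.v *)
From HB Require Import structures.
From mathcomp Require Import all_boot all_order all_algebra all_fingroup.
From mathcomp Require Import all_solvable all_field.
From mathcomp Require Import boolp classical_sets.

Set Implicit Arguments.
Unset Strict Implicit.
Unset Printing Implicit Defensive.

Import GRing.Theory.

Local Open Scope ring_scope.

(* R[G].  The alias keeps the convolution product apart from the pointwise    *)
(* product that the library puts on {ffun gT -> R}.                           *)
Section GroupRing.
Variables (R : nzRingType) (gT : finGroupType).

Definition group_ring := {ffun gT -> R}.

HB.instance Definition _ := GRing.Zmodule.copy group_ring {ffun gT -> R}.

Definition gr_coef (x : group_ring) (g : gT) : R := (x : {ffun gT -> R}) g.

Definition gr_elt (g : gT) : group_ring := [ffun h => (h == g)%:R].

Definition gr_mul (x y : group_ring) : group_ring :=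
  [ffun g => \sum_h gr_coef x h * gr_coef y (h^-1 * g)%g].

Let grP (x y : group_ring) : gr_coef x =1 gr_coef y -> x = y.
Proof. by move=> h; apply/ffunP. Qed.

Fact gr_mulA : associative gr_mul.
Proof.
move=> x y z; apply: grP => g; rewrite /gr_coef !ffunE.
under eq_bigr do rewrite /gr_coef ffunE mulr_sumr.
under [RHS]eq_bigr do rewrite /gr_coef ffunE mulr_suml.
rewrite exchange_big /= [RHS]exchange_big /= [LHS]exchange_big /=.
apply: eq_bigr => h _.
rewrite (reindex_inj (mulgI h^-1%g)) /=.
by apply: eq_bigr => k _; rewrite mulrA /gr_coef invMg invgK -mulgA mulKVg.
Qed.

Fact gr_mul1 : left_id (gr_elt 1%g) gr_mul.
Proof.
move=> x; apply: grP => g; rewrite /gr_coef !ffunE (bigD1 1%g) //=.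
rewrite /gr_coef ffunE eqxx mul1r invg1 mul1g big1 ?addr0 // => h /negPf h1.
by rewrite ffunE h1 mul0r.
Qed.

Fact gr_mulr1 : right_id (gr_elt 1%g) gr_mul.
Proof.
move=> x; apply: grP => g; rewrite /gr_coef !ffunE (bigD1 g) //=.
rewrite /gr_coef ffunE mulVg eqxx mulr1 big1 ?addr0 // => h hg.
by rewrite ffunE -eq_mulVg1 (negPf hg) mulr0.
Qed.

Fact gr_mulDl : left_distributive gr_mul +%R.
Proof.
move=> x y z; apply: grP => g; rewrite /gr_coef !ffunE -big_split /=.
by apply: eq_bigr => h _; rewrite /gr_coef ffunE mulrDl.
Qed.

Fact gr_mulDr : right_distributive gr_mul +%R.
Proof.
move=> x y z; apply: grP => g; rewrite /gr_coef !ffunE -big_split /=.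
by apply: eq_bigr => h _; rewrite /gr_coef ffunE mulrDr.
Qed.

Fact gr_1neq0 : gr_elt 1%g != 0.
Proof.
apply/eqP => /(congr1 (gr_coef^~ 1%g)) /eqP.
by rewrite /gr_coef !ffunE eqxx oner_eq0.
Qed.

HB.instance Definition _ := GRing.Zmodule_isNzRing.Build group_ring
  gr_mulA gr_mul1 gr_mulr1 gr_mulDl gr_mulDr gr_1neq0.

End GroupRing.

(* A formal power series over R is given by its coefficients nat -> R.        *)
Section Series.
Variable R : nzRingType.

(* The polynomial equal to the series f, and 0 if f is not a polynomial.      *)
Definition poly_of_series (f : nat -> R) : {poly R} :=
  xget 0 [set r : {poly R} | forall k, r`_k = f k]%classic.

(* f / (1 - X) *)
Definition div_1subX (f : nat -> R) : nat -> R :=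
  fun k => \sum_(j < k.+1) f j.

End Series.

(* W(k), for k a perfect field of characteristic p, is the ring of            *)
(* characteristic 0 which is complete and separated for the p-adic topology,  *)
(* has no p-torsion, and has residue ring W / pW = k; these properties        *)
(* determine (W, red) up to a unique isomorphism.                             *)
Record is_witt_ring (p : nat) (k : nzRingType) (W : comNzRingType)
    (red : {rmorphism W -> k}) : Prop := IsWittRing {
  witt_red_surj : forall c : k, exists x : W, red x = c;
  witt_red_ker : forall x : W, red x = 0 <-> exists y, x = p%:R * y;
  witt_torsion_free : forall x : W, p%:R * x = 0 -> x = 0;
  witt_separated : forall x : W,
    (forall m, exists y, x = p%:R ^+ m * y) -> x = 0;
  witt_complete : forall u : nat -> W,
    (forall m, exists y, u m.+1 - u m = p%:R ^+ m * y) ->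
    exists l, forall m, exists y, l - u m = p%:R ^+ m * y
}.

Section Carlitz.
Variable F : finFieldType.
Local Notation A := {poly F}.
Local Notation K := {fraction {poly F}}.

(* An element \sum_i c_i tau^i of K{tau} is represented by the q-linear       *)
(* polynomial \sum_i c_i X^(q^i), so that the product of K{tau} becomes       *)
(* composition; phi_theta is left multiplication by Phi_theta.                *)
Definition phi_theta (f : {poly K}) : {poly K} :=
  tofrac ('X : A) *: f + f ^+ #|F|.

Definition carlitz (a : A) : {poly K} :=
  \sum_(i < size a) tofrac (a`_i)%:P *: iter i phi_theta 'X.

Section Extension.
Variable L : splittingFieldType K.

Definition of_A (a : A) : L := (tofrac a)%:A.

Definition carlitz_in (a : A) : {poly L} := map_poly (in_alg L) (carlitz a).

Definition torsion (a : A) (x : L) : Prop := root (carlitz_in a) x.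

Definition integral (x : L) : Prop := integralOver of_A x.

Record prime_above (Q : A) (I : L -> Prop) : Prop := PrimeAbove {
  prime_above_integral : forall x, I x -> integral x;
  prime_above0 : I 0;
  prime_aboveD : forall x y, I x -> I y -> I (x + y);
  prime_aboveM : forall a x, integral a -> I x -> I (a * x);
  prime_above_proper : ~ I 1;
  prime_above_prime : forall x y, integral x -> integral y ->
    I (x * y) -> I x \/ I y;
  prime_above_over : forall a : A, I (of_A a) <-> Q %| a
}.

(* Arithmetic Frobenius.  The extensions considered are abelian and           *)
(* unramified at Q, so the same automorphism works for every prime above Q.   *)
Definition is_frobenius (Q : A) (s : gal_of {:L}) : Prop :=
  forall I, prime_above Q I -> forall x, integral x ->
    I (s x - x ^+ (#|F| ^ (size Q).-1)).

Variables (P : A) (p : nat).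

(* For L the field of P^(n+1)-torsion, the p-Sylow subgroup of Gal(L / K) is  *)
(* the kernel of restriction to the field of P-torsion, and Delta is its      *)
(* complement, which acts faithfully on the P-torsion.                        *)
Definition Delta : {group gal_of {:L}} := 'O_p^'('Gal({:L} / 1))%G.

(* in_qpoly P a is the class of a in A / P.                                   *)
Definition is_teichmuller (W : comNzRingType)
    (red : {rmorphism W -> {poly %/ P}}) (omega : gal_of {:L} -> W) : Prop :=
  forall (delta : gal_of {:L}) (a : A), delta \in Delta -> ~~ (P %| a) ->
    (forall e, torsion P e -> delta e = (carlitz_in a).[e]) ->
    omega delta ^+ (#|F| ^ (size P).-1 - 1) = 1 /\
    red (omega delta) = in_qpoly P a.

Variable Fr : A -> gal_of {:L}.

(* Coefficient of X^k in the Euler product over the monic irreducibles Q <> P.*)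
(* Each factor is the geometric series of Fr_Q^-1 X^(deg Q), truncated after  *)
(* its k-th term, and the factors with deg Q > k are omitted: neither changes *)
(* the coefficient of X^k.                                                    *)
Definition stickelberger (k : nat) : group_ring int (gal_of {:L}) :=
  (\prod_(Q : {poly_k.+1 F} |
           [&& (Q : A) \is monic, `[< irreducible_poly (Q : A) >]
             & (Q : A) != P])
     \sum_(j < k.+1)
       (gr_elt int ((Fr Q)^-1 ^+ j)%g)%:P * 'X^(j * (size (Q : A)).-1))`_k.

(* The image of x under delta * sigma |-> chi(delta) sigma.                   *)
Definition chi_part (W : comNzRingType) (chi : gal_of {:L} -> W)
    (Gamma : {group gal_of {:L}}) (x : group_ring int (gal_of {:L})) :
    group_ring W [subg Gamma] :=
  [ffun s => \sum_(delta in Delta)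
     (gr_coef x (delta * sgval s)%g)%:~R * chi delta].

Definition stickelberger_chi (W : comNzRingType) (chi : gal_of {:L} -> W)
    (Gamma : {group gal_of {:L}}) (k : nat) : group_ring W [subg Gamma] :=
  chi_part chi Gamma (stickelberger k).

(* Theta^#(X, omega^i) *)
Definition stickelberger_sharp (W : comNzRingType) (omega : gal_of {:L} -> W)
    (Gamma : {group gal_of {:L}}) (i : nat) : {poly group_ring W [subg Gamma]} :=
  let theta := stickelberger_chi (fun delta => omega delta ^+ i) Gamma in
  poly_of_series (if (#|F|.-1 %| i)%N then div_1subX theta else theta).

End Extension.

(* L n is the field generated over K by the P^(n+1)-torsion; the inclusions   *)
(* L n < L n.+1 inside an algebraic closure are given as embeddings over K.   *)
Section Tower.
Variables (L : nat -> splittingFieldType K).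
Variable emb : forall n, 'AHom(L n, L n.+1).

Definition is_carlitz_tower (P : A) : Prop :=
  forall n, splittingFieldFor 1 (carlitz_in (L n) (P ^+ n.+1)) {:L n}.

Fixpoint emb0 (n : nat) : 'AHom(L 0, L n) :=
  if n is m.+1 then (emb m \o emb0 m)%AF else \1%AF.

Definition Gamma (n : nat) : {group gal_of {:L n}} :=
  'Gal({:L n} / limg (emb0 n))%G.

Definition restricts (n : nat) (s' : gal_of {:L n.+1}) (s : gal_of {:L n}) :
    Prop :=
  forall x, s' (emb n x) = emb n (s x).

Section IwasawaAlgebra.
Variable W : comNzRingType.

Definition res_ring (n : nat) (y : group_ring W [subg Gamma n.+1]) :
    group_ring W [subg Gamma n] :=
  [ffun s => \sum_(s' | `[< restricts (sgval s') (sgval s) >]) gr_coef y s'].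

(* W[[Gamma]] = lim_n W[Gamma_n], inside the product of the W[Gamma_n].       *)
Definition Lambda : set (forall n, group_ring W [subg Gamma n]) :=
  [set y | forall n, res_ring (n:=n) (y n.+1) = y n]%classic.

Definition pLambda (p : nat) : set (forall n, group_ring W [subg Gamma n]) :=
  [set x | exists y, Lambda y /\ forall n, x n = p%:R * y n]%classic.

Definition Theta_inf (P : A) (p : nat) (omega : forall n, gal_of {:L n} -> W)
    (Fr : forall n, A -> gal_of {:L n}) (i : nat) :
    forall n, group_ring W [subg Gamma n] :=
  fun n => (stickelberger_sharp P p (Fr n) (omega n) (Gamma n) i).[1].

End IwasawaAlgebra.
End Tower.
End Carlitz.

(* Main.v *)
(** Let m = n + 1 and j = q^d - 1 - i. The Frobenius at a monic irreducible Q
    other than P acts on the P^m-torsion as Phi_Q, so the Galois group is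
    (A / P^m)^* and the coefficient of X^k in the Stickelberger series is the
    sum of the sigma_a^-1 over the monic a of degree k prime to P. If the
    value at X = 1 of the omega^i-component were divisible by p, reducing its
    coefficient at each s in Gamma_n would give P | sum a^j, the sum being over
    the a whose class has Gamma-part s^-1. On such a class the (q^d)^m-th power
    map multiplies all a by one and the same factor, so raising the congruence
    to the power (q^d)^m upgrades it to a congruence modulo P^m. Adding up over
    s, P^m divides (1 - P^j) times the Goss-Carlitz value
    b(j) = sum_k sum_(a monic of degree k) a^j (or its derivative in X if
    q - 1 divides j), a fixed polynomial independent of n once m is large.
    Hence that value is 0; but its value at theta = 0 is 1. *)

(* A congruence modulo P alone would prove nothing: the Goss-Carlitz value is a nonzero polynomial
   that may be divisible by P, and only divisibility by unboundedly high powers of P is absurd. The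
   extra strength comes from using the coefficient at each s in Gamma_n separately before adding up.
   The exponent (q^d)^m is chosen for three properties. It is a power of p, so raising to it is
   additive; it is at least m, so a multiple of P becomes a multiple of P^m; it is 1 modulo q^d - 1,
   so it is trivial on Delta and moves only the Gamma-part of a class. The exponent j stands for -i,
   because the inverses of the sigma_a occur and a^(q^d - 1) = 1 modulo P. The factor 1 - P^j is the
   Euler factor at P, and is prime to P. If q - 1 divides j the Goss-Carlitz value itself is 0, the
   terms of degree 0 and 1 cancelling at theta = 0; dividing by 1 - X is what makes a nonzero value
   appear. *)
Require Import Defs.
From HB Require Import structures.
From mathcomp Require Import all_boot all_order all_algebra all_fingroup.
From mathcomp Require Import all_solvable all_field.
From mathcomp Require Import boolp classical_sets.

Set Implicit Arguments.
Unset Strict Implicit.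
Unset Printing Implicit Defensive.

Import GRing.Theory.

Local Open Scope ring_scope.

(** * Power sums of monic polynomials over a finite field *)

Section FiniteField.
Variable F : finFieldType.

(** Translation by 1 permutes F, so the sum of all elements equals itself plus q. *)
Lemma natr_card_finField : #|F|%:R = 0 :> F.
Proof.
apply: (addIr (\sum_(x : F) x)); rewrite add0r -sumr_const -big_split /=.
by rewrite [RHS](reindex_inj (addrI (1 : F))).
Qed.

Lemma finField_expf_pred (c : F) : c != 0 -> c ^+ #|F|.-1 = 1.
Proof.
move=> c0; apply: (mulfI c0); rewrite -exprS mulr1 prednK ?expf_card //.
exact: ltnW (finNzRing_gt1 F).
Qed.

(** Otherwise the q - 1 units of F would all be roots of X^r - 1, where r = j mod (q - 1) satisfies
    0 < r < q - 1. Also applied below to the residue field A / P. *)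
Lemma finField_expf_neq1 (j : nat) :
  ~~ (#|F|.-1 %| j)%N -> exists2 x : F, x != 0 & x ^+ j != 1.
Proof.
move=> nj; have [q1 | q1] := leqP #|F|.-1 0.
  by have := finNzRing_gt1 F; move: q1; case: #|F| => [|[]].
have: (0 < j %% #|F|.-1)%N by rewrite lt0n.
set r := (j %% _)%N => r0.
have rlt : (r < #|F|.-1)%N by rewrite ltn_mod.
apply: contrapT => H.
have H1 (x : F) : x != 0 -> x ^+ j = 1.
  by move=> x0; apply/eqP/negPn/negP => xj; apply: H; exists x.
have := max_unity_roots (rs := rem 0 (enum F)) r0.
rewrite rem_uniq ?enum_uniq // size_rem ?mem_enum // -cardE => /(_ _ isT) Hm.
suff /Hm/leq_ltn_trans/(_ rlt) : all (r.-unity_root) (rem 0 (enum F)) by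
  rewrite ltnn.
apply/allP => x; rewrite mem_rem_uniq ?enum_uniq // !inE => /andP[x0 _].
apply/unity_rootP; have := H1 x x0; rewrite (divn_eq j #|F|.-1) -/r.
by rewrite mulnC exprD exprM finField_expf_pred // expr1n mul1r.
Qed.

Lemma sum_expr_finField (j : nat) : (0 < j)%N ->
  \sum_(c : F) c ^+ j = if (#|F|.-1 %| j)%N then -1 else 0.
Proof.
move=> j0; case: ifPn => [dj | /finField_expf_neq1[x x0 xj]].
  rewrite (bigD1 0) //= expr0n gtn_eqF // add0r (eq_bigr (fun=> 1)) => [|c c0].
    rewrite sumr_const cardC1 -subn1 natrB; last first.
      exact: ltnW (finNzRing_gt1 F).
    by rewrite natr_card_finField sub0r.
  by have /dvdnP[m ->] := dj; rewrite mulnC exprM finField_expf_pred ?expr1n.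
set S := \sum_c _; have : x ^+ j * S = S.
  rewrite mulr_sumr [RHS](reindex_inj (mulfI x0)) /=.
  by apply: eq_bigr => c _; rewrite exprMn.
move/eqP; rewrite -subr_eq0 -{2}[S]mul1r -mulrBl mulf_eq0 subr_eq0 (negPf xj).
by move/eqP.
Qed.

Implicit Types (k m n j : nat) (V : zmodType).

Definition monic_deg k (a : {poly F}) := (a \is monic) && (size a == k.+1).

Lemma big_npoly0 V (G : {poly F} -> V) : \sum_(b : {poly_0 F}) G b = G 0.
Proof.
rewrite (bigD1 0) //= big1 ?addr0 // => b; rewrite -val_eqE /=.
by have := size_npoly b; rewrite leqn0 size_poly_eq0 => ->.
Qed.

Lemma big_npoly_recr V k (G : {poly F} -> V) :
  \sum_(a : {poly_k.+1 F}) G a =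
  \sum_(c : F) \sum_(b : {poly_k F}) G (c *: 'X^k + b).
Proof.
pose h (u : F * {poly_k F}) : {poly_k.+1 F} :=
  npolyp k.+1 (u.1 *: 'X^k + (u.2 : {poly F})).
pose h' (a : {poly_k.+1 F}) : F * {poly_k F} := (a`_k, npolyp k a).
have hE u : h u = u.1 *: 'X^k + u.2 :> {poly F}.
  rewrite npolypK // (leq_trans (size_polyD _ _)) // geq_max.
  rewrite (leq_trans (size_scale_leq _ _)) ?size_polyXn //.
  exact: leqW (size_npoly _).
rewrite pair_big /= (reindex_onto h h') /=.
  apply: eq_big => [u | u _]; last by rewrite hE.
  suff -> : h' (h u) = u by rewrite eqxx.
  apply: injective_projections; rewrite /h' /= hE.
    by rewrite coefD coefZ coefXn eqxx mulr1 big_coef_npoly ?addr0.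
  apply/val_inj/polyP => i; rewrite /= coef_npolyp coefD coefZ coefXn.
  case: ltnP => ik; last by rewrite big_coef_npoly.
  by rewrite ltn_eqF // mulr0 add0r.
move=> a _; apply/val_inj; rewrite [LHS]hE /=; apply/polyP => i.
rewrite coefD coefZ coefXn coef_npolyp.
case: ltngtP => [ik | ik | ->]; rewrite ?mulr0 ?add0r ?mulr1 ?addr0 //.
by rewrite big_coef_npoly.
Qed.

Lemma big_npoly_monic V k N (G : {poly F} -> V) : (k < N)%N ->
  \sum_(a : {poly_N F} | monic_deg k a) G a =
  \sum_(b : {poly_k F}) G ('X^k + (b : {poly F})).
Proof.
move=> kN.
pose h (b : {poly_k F}) : {poly_N F} := npolyp N ('X^k + (b : {poly F})).
pose h' (a : {poly_N F}) : {poly_k F} := npolyp k a.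
have sX (b : {poly_k F}) : size ('X^k + (b : {poly F})) = k.+1.
  by rewrite size_polyDl size_polyXn // ltnS; exact: size_npoly.
have hE b : h b = 'X^k + b :> {poly F} by rewrite npolypK ?sX.
rewrite (reindex_onto h h') /=.
  apply: eq_big => [b | b _]; last by rewrite hE.
  rewrite /monic_deg hE sX eqxx andbT monicE lead_coefDl ?lead_coefXn ?eqxx;
    last first.
    by rewrite size_polyXn ltnS size_npoly.
  suff -> : h' (h b) = b by rewrite eqxx.
  apply/val_inj/polyP => i; rewrite /= coef_npolyp hE coefD coefXn.
  case: ltnP => ik; last by rewrite big_coef_npoly.
  by rewrite ltn_eqF // add0r.
move=> a /andP[/monicP am /eqP sa]; apply/val_inj; rewrite [LHS]hE /=.
apply/polyP => i; rewrite coefD coefXn coef_npolyp.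
case: ltngtP => [ik | ik | ->]; rewrite ?add0r ?addr0 //.
  by rewrite nth_default // sa.
by rewrite -am lead_coefE sa.
Qed.

(* Averaging f over the translates by c *: 'X^k, c in F, lowers its degree:
   the top coefficient gets multiplied by #|F| = 0. *)
Lemma sum_horner_npoly k (f : {poly {poly F}}) (x : {poly F}) :
  (size f <= k)%N -> \sum_(a : {poly_k F}) f.[x + (a : {poly F})] = 0.
Proof.
elim: k f x => [|k IHk] f x sf.
  by rewrite big1 // => a _; move: sf; rewrite size_poly_leq0 => /eqP->;
    rewrite horner0.
rewrite (big_npoly_recr k (fun a => f.[x + a])) exchange_big /=.
pose g := \sum_(c : F) (f \Po ('X + (c *: 'X^k)%:P)).
rewrite (eq_bigr (fun a : {poly_k F} => g.[x + (a : {poly F})])); last first.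
  move=> a _; rewrite horner_sum; apply: eq_bigr => c _.
  by rewrite horner_comp !hornerE; congr (f.[_]); exact: addrAC.
apply: IHk; apply/leq_sizeP => i ki; rewrite coef_sum.
rewrite (eq_bigr (fun=> f`_i)) ?sumr_const ?cardT.
  by rewrite -cardE -mulr_natr -polyC_natr natr_card_finField mulr0.
move=> c _; set w := (_ *: _).
have sw : size ('X + w%:P) = 2.
  by rewrite size_polyDl ?size_polyX // size_polyC; case: (w != 0).
move: ki; rewrite leq_eqVlt => /orP[/eqP<-| ki]; last first.
  by rewrite !nth_default // ?size_comp_poly2 // (leq_trans sf).
move: sf; rewrite leq_eqVlt => /orP[/eqP sf | sf]; last first.
  by rewrite !nth_default // size_comp_poly2.
have := lead_coef_comp f (q := 'X + w%:P).
rewrite sw => /(_ isT);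
  rewrite lead_coefDl ?lead_coefX ?size_polyX ?size_polyC; last first.
  by case: (w != 0).
by rewrite expr1n mulr1 !lead_coefE size_comp_poly2 // sf.
Qed.

Lemma big_monic_deg_dvdp V k N e (Q : {poly F}) (G : {poly F} -> V) :
    (k < N)%N -> monic_deg e Q ->
  \sum_(a : {poly_N F} | monic_deg k a && (Q %| a)) G a =
  if (e <= k)%N then
    \sum_(b : {poly_N F} | monic_deg (k - e) b) G (Q * b) else 0.
Proof.
move=> kN /andP[Qm /eqP sQ]; have Q0 : Q != 0 by apply: monic_neq0.
case: leqP => [ek | ke]; last first.
  rewrite big_pred0 // => a; apply/negP => /andP[/andP[am /eqP sa]].
  move/dvdp_leq; rewrite monic_neq0 // sa sQ => /(_ isT).
  by rewrite ltnS leqNgt ke.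
have sM (b : {poly F}) : monic_deg k (Q * b) = monic_deg (k - e) b.
  rewrite /monic_deg monicMl //; case: (boolP (b \is monic)) => //= bm.
  rewrite size_Mmonic // sQ addSn -pred_Sn.
  by rewrite -[size b]prednK ?size_poly_gt0 ?monic_neq0 //
    !addnS /= !eqSS -[in RHS](eqn_add2l e) subnKC.
pose h (b : {poly_N F}) : {poly_N F} := npolyp N (Q * b).
pose h' (a : {poly_N F}) : {poly_N F} := npolyp N ((a : {poly F}) %/ Q).
have hE (b : {poly F}) : monic_deg (k - e) b -> npolyp N (Q * b) = Q * b :>
  {poly F}.
  by rewrite -sM => /andP[_ /eqP s]; rewrite npolypK // s.
have h'E (a : {poly_N F}) : h' a = (a : {poly F}) %/ Q :> {poly F}.
  by rewrite npolypK // (leq_trans (leq_divp _ _)) // size_npoly.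
rewrite (reindex_onto h h') /=.
  symmetry; apply: eq_big => [b | b]; last by move=> /hE; rewrite /h => ->.
  apply/idP/andP => [bk | [/andP[hk Qh] /eqP hh]].
    rewrite /h hE // sM bk dvdp_mulr //; split=> //.
    by apply/eqP/val_inj; rewrite /= h'E /h hE // mulKp.
  rewrite -sM; suff <- : h b = Q * b :> {poly F} by [].
  by rewrite -(divpK Qh) -h'E hh mulrC.
move=> a /andP[ak Qa]; apply/val_inj; rewrite /= /h h'E.
have E : Q * (a %/ Q) = a by rewrite mulrC divpK.
by rewrite E npolypK // size_npoly.
Qed.

Definition monic_power_sum k j : {poly F} :=
  \sum_(b : {poly_k F}) ('X^k + (b : {poly F})) ^+ j.

Definition monic_power_sum_coprime (P : {poly F}) k j : {poly F} :=
  \sum_(b : {poly_k F} | ~~ (P %| 'X^k + (b : {poly F}))) ('X^k + (b : {poly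
    F})) ^+ j.

Lemma monic_power_sum_eq0 k j : (j < k)%N -> monic_power_sum k j = 0.
Proof.
move=> jk; rewrite -(@sum_horner_npoly k ('X^j) 'X^k) ?size_polyXn //.
by apply: eq_bigr => b _; rewrite hornerXn.
Qed.

(** The multiples of P of degree k are P times the monic polynomials of degree k - d. Summed over k,
    this shift produces the factor 1 - P^j. *)
Lemma monic_power_sum_split (P : {poly F}) d k j : monic_deg d P ->
  monic_power_sum k j = monic_power_sum_coprime P k j +
    (if (d <= k)%N then P ^+ j * monic_power_sum (k - d) j else 0).
Proof.
move=> Pd; rewrite /monic_power_sum (bigID (fun b : {poly_k F} =>
  P %| 'X^k + (b : {poly F}))) /=.
rewrite addrC; congr (_ + _); rewrite big_mkcond /=.
rewrite -(@big_npoly_monic _ k k.+1 (fun a => if P %| a then a ^+ j else 0)) //.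
rewrite -big_mkcondr (@big_monic_deg_dvdp _ k k.+1 d P (fun a => a ^+ j)) //;
  case: leqP => // dk.
rewrite (@big_npoly_monic _ (k - d) _ (fun b =>
  (P * b) ^+ j)) ?ltnS ?leq_subr //.
by rewrite mulr_sumr; apply: eq_bigr => b _; rewrite exprMn.
Qed.

(** For k > 0 only the constant term of a monic polynomial survives at theta = 0. For k > 1 a
    further coefficient runs freely over F, and the sum is a multiple of q. *)
Lemma horner0_monic_power_sum k j : (0 < j)%N -> (monic_power_sum k j).[0] =
  match k with 0 => 1 | 1 => if (#|F|.-1 %| j)%N then -1 else 0 | _ => 0 end.
Proof.
move=> j0; rewrite /monic_power_sum horner_sum; case: k => [|k].
  by rewrite (@big_npoly0 _ (fun b => ((_ + b) ^+ j).[0])) addr0 expr1n hornerC.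
under eq_bigr do rewrite horner_exp hornerD hornerXn exprS mul0r add0r.
rewrite (@big_npoly_recr _ k (fun b => b.[0] ^+ j)) -sum_expr_finField //.
case: k => [|k].
  apply: eq_bigr => c _; rewrite (@big_npoly0 _ (fun b => (_ + b).[0] ^+ j)).
  by rewrite !hornerE.
rewrite exchange_big /= big1 // => b _.
rewrite (eq_bigr (fun=> b.[0] ^+ j)) ?sumr_const ?cardT.
  by rewrite -cardE -mulr_natr natr_card_finField mulr0.
by move=> c _; rewrite hornerD hornerZ hornerXn exprS mul0r mulr0 add0r.
Qed.

(** Each nonzero polynomial is a unique scalar times a monic one. The values lie in any additive
    group because the lemma serves both power sums in A and twisted sums in W. *)
Lemma sum_npoly_homogeneous V m (G : {poly F} -> V) :
  (forall c a, c != 0 -> G (c *: a) = G a) ->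
  \sum_(a : {poly_m F}) G a =
  G 0 + (\sum_(k < m) \sum_(b : {poly_k F}) G ('X^k + (b : {poly F}))) *+
    #|F|.-1.
Proof.
move=> GZ; elim: m => [|m IHm].
  by rewrite big_ord0 mul0rn addr0 big_npoly0.
rewrite (@big_npoly_recr _ m G) big_ord_recr mulrnDl addrA -IHm.
rewrite (bigD1 0) //=; congr (_ + _).
  by apply: eq_bigr => b _; rewrite scale0r add0r.
rewrite -(cardC1 (0 : F)) -sumr_const; apply: eq_bigr => c c0.
rewrite (reindex_inj (h := fun b : {poly_m F} => c *: b)) /=; last first.
  exact: can_inj (scalerK c0).
by apply: eq_bigr => b _; rewrite -scalerDr GZ.
Qed.

Lemma sum_npoly_expr m j : (0 < j)%N -> (#|F|.-1 %| j)%N ->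
  \sum_(a : {poly_m F}) (a : {poly F}) ^+ j = - \sum_(k < m) monic_power_sum k
    j.
Proof.
move=> j0 jq; rewrite (@sum_npoly_homogeneous _ m (fun a => a ^+ j)).
  rewrite expr0n gtn_eqF // add0r -subn1 mulrnBr;
    last exact: ltnW (finNzRing_gt1 F).
  by rewrite -[X in X - _]mulr_natr -polyC_natr natr_card_finField mulr0 sub0r.
move=> c a c0; have /dvdnP[i ->] := jq.
by rewrite exprZn mulnC exprM finField_expf_pred // expr1n scale1r.
Qed.

End FiniteField.

(** * Goss-Carlitz values are not divisible by high powers of P *)

Section PowerSumCongruence.
Variables (F : finFieldType) (P : {poly F}) (d j : nat).
Hypotheses (P_deg : monic_deg d P) (d_gt0 : (0 < d)%N) (j_gt0 : (0 < j)%N).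

Let shift (t : nat -> {poly F}) k := if (d <= k)%N then t (k - d)%N else 0.

Let sum_shift t m : \sum_(k < m) shift t k = \sum_(k < m - d) t k.
Proof.
elim: m => [|m IHm]; first by rewrite sub0n !big_ord0.
rewrite big_ord_recr IHm /= /shift; case: leqP => dm.
  by rewrite subSn // big_ord_recr.
by rewrite addr0 (eqP (ltnW dm)) (eqP dm).
Qed.

Let sum_stable (t : nat -> {poly F}) m : (forall k, (j < k)%N -> t k = 0) ->
  (j < m)%N -> \sum_(k < m) t k = \sum_(k < j.+1) t k.
Proof.
move=> t0 jm; rewrite (big_ord_widen m t jm) [LHS](bigID (fun k : 'I_m =>
  (k < j.+1)%N)) /=.
by rewrite [X in _ + X]big1 ?addr0 // => k; rewrite -leqNgt => /t0.
Qed.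

(** Here t is the sequence of power sums in the odd case and of their partial sums in the even case.
    The sum telescopes to (1 - P^j) * b, where 1 - P^j is prime to P and b is nonzero because of its
    value at theta = 0. *)
Let not_dvdp_sum_shift (t : nat -> {poly F}) :
    (forall k, (j < k)%N -> t k = 0) -> (\sum_(k < j.+1) t k).[0] = 1 ->
  exists n, ~~ (P ^+ n.+1 %| \sum_(k < d * n.+1) (t k - P ^+ j * shift t k)).
Proof.
(* The summand [j.+1] makes the shifted sum, which stops at d * n, already complete; the summand
   [size b] makes P^(n+1) too large to divide b. *)
move=> t0; set b := \sum_(k < j.+1) t k => b0; pose n := (j.+1 + size b)%N.
have jn : (j < d * n)%N.
  by rewrite (@leq_trans n) ?leq_addr // leq_pmull.
exists n; rewrite sumrB -mulr_sumr sum_shift.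
rewrite [(d * n.+1)%N]mulnS addKn !sum_stable // ?(leq_trans jn) ?leq_addl //
  -/b.
have -> : b - P ^+ j * b = (1 - P ^+ j) * b by rewrite mulrBl mul1r.
have /andP[Pm /eqP sP] := P_deg.
rewrite Gauss_dvdpr; last first.
  rewrite coprimep_pexpl // -(prednK j_gt0) exprSr addrC -mulNr.
  by rewrite coprimep_addl_mul coprimep1.
apply/negP => /dvdp_leq; rewrite -size_poly_gt0.
have bn0 : b != 0 by apply/eqP => b00; move: b0; rewrite b00 horner0 => /eqP;
  rewrite eq_sym oner_eq0.
rewrite size_poly_gt0 => /(_ bn0).
rewrite leqNgt => /negP; apply;
  rewrite (leq_trans _ (leq_pred _)) // size_exp sP.
rewrite (@leq_trans n.+1) ?ltnS ?leq_addl //; exact: leq_pmull.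
Qed.

Let coprime_sum k : monic_power_sum_coprime P k j =
  monic_power_sum F k j - P ^+ j * shift (fun k => monic_power_sum F k j) k.
Proof.
by rewrite (@monic_power_sum_split _ P d) // /shift; case: leqP => _;
  rewrite ?addrK ?mulr0 ?subr0 ?addr0.
Qed.

Lemma not_dvdp_sum_coprime_odd : ~~ (#|F|.-1 %| j)%N ->
  exists n, ~~ (P ^+ n.+1 %| \sum_(k < d * n.+1) monic_power_sum_coprime P k j).
Proof.
move=> jq; have [||n Hn] := not_dvdp_sum_shift (t := fun k =>
  monic_power_sum F k j).
- by move=> k; exact: monic_power_sum_eq0.
- rewrite horner_sum big_ord_recl big1 ?horner0_monic_power_sum ?addr0 // =>
  k _.
  by rewrite lift0 horner0_monic_power_sum // (negPf jq); case: (nat_of_ord k).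
by exists n; move: Hn; under eq_bigr do rewrite -coprime_sum.
Qed.

(** The inner sums are the coefficients after division by 1 - X. At theta = 0 the power sums are 1,
    -1, 0, 0, ..., so their partial sums are 1, 0, 0, ... and add up to 1. For m > j a partial sum
    vanishes, being minus the sum of a^j over all a of size at most m + 1. *)
Lemma not_dvdp_sum_coprime_even : (#|F|.-1 %| j)%N ->
  exists n, ~~ (P ^+ n.+1 %| \sum_(m < d * n.+1) \sum_(k < m.+1)
    monic_power_sum_coprime P k j).
Proof.
move=> jq; pose t m := \sum_(k < m.+1) monic_power_sum F k j.
have [||n Hn] := not_dvdp_sum_shift (t := t).
- move=> m jm; apply/eqP; rewrite -oppr_eq0 -sum_npoly_expr //; apply/eqP.
  rewrite -[RHS](@sum_horner_npoly F m.+1 ('X^j) 0) ?size_polyXn 1?ltnW //.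
  by apply: eq_bigr => a _; rewrite hornerXn add0r.
- rewrite horner_sum big_ord_recl big1 ?addr0 /= => [|k _].
    by rewrite /t big_ord1 horner0_monic_power_sum.
  rewrite /t horner_sum 2!big_ord_recl big1 => [|i _].
    by rewrite !horner0_monic_power_sum // jq addr0 subrr.
  by rewrite horner0_monic_power_sum.
exists n; move: Hn.
rewrite (eq_bigr (fun m : 'I__ =>
  \sum_(k < m.+1) monic_power_sum_coprime P k j)) // => m _.
under eq_bigr do rewrite coprime_sum.
rewrite sumrB -mulr_sumr sum_shift /t; congr (_ - _ * _); rewrite /shift.
case: leqP => dm; first by rewrite subSn.
by rewrite (eqP dm) big_ord0.
Qed.

End PowerSumCongruence.

(** * Coefficients of Euler products *)

Section MonicIrreducible.
Variable F : finFieldType.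
Implicit Types a b Q : {poly F}.

Definition monic_irreducible Q := (Q \is monic) && irreducibleb Q.

Lemma monic_irreducible_dvdp Q a :
  monic_irreducible Q -> monic_irreducible a -> (Q %| a) = (Q == a).
Proof.
move=> /andP[Qm /irreducibleP [sQ _]] /andP[am /irreducibleP [_ ai]].
apply/idP/eqP => [Qa | ->]; last exact: dvdpp.
have := ai Q _ Qa; rewrite gtn_eqF // => /(_ isT).
by rewrite eqp_monic // => /eqP.
Qed.

Lemma monic_irreducible_dvdpM Q a b : monic_irreducible Q ->
  (Q %| a * b) = (Q %| a) || (Q %| b).
Proof.
move=> /andP[_ /irreducibleP Qi]; apply/idP/orP; last first.
  by case=> [/dvdp_mulr -> | /dvdp_mull ->].
have [Qa | Qa] := boolP (Q %| a); first by left.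
by rewrite Gauss_dvdpr ?irreducible_poly_coprime //; right.
Qed.

Lemma exists_monic_irreducible_dvdp a : (1 < size a)%N ->
  exists2 Q, monic_irreducible Q & Q %| a.
Proof.
have [n] := ubnP (size a); elim: n a => // n IHn a /ltnSE-sa a1.
have a0 : a != 0 by rewrite -size_poly_gt0 ltnW.
have [ai | /irreducibleP ai] := boolP (irreducibleb a).
  have l0 : (lead_coef a)^-1 != 0 by rewrite invr_eq0 lead_coef_eq0.
  exists ((lead_coef a)^-1 *: a); last by rewrite dvdpZl.
  rewrite /monic_irreducible monicE lead_coefZ mulVf ?lead_coef_eq0 // eqxx /=.
  apply/irreducibleP; move/irreducibleP: ai => [_ ai]; split.
    by rewrite size_scale.
  move=> q q1; rewrite dvdpZr // => /(ai q q1)/eqp_trans -> //.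
  by rewrite eqp_sym eqp_scale.
have [q [q1 qa qna]] : exists q : {poly F}, [/\ size q != 1, q %| a & ~~ (q %=
  a)].
  apply: contrapT => H; apply: ai; split=> // q q1 qa.
  by apply/negPn/negP => qna; apply: H; exists q.
have q0 : q != 0 by apply: contraNneq a0 => q0; rewrite -dvd0p -q0.
have [||Q Qi Qq] := IHn q; last by exists Q => //; exact: dvdp_trans Qq qa.
  rewrite (leq_trans _ sa) // ltn_neqAle dvdp_leq // andbT.
  by apply: contra qna; rewrite dvdp_size_eqp.
by rewrite ltn_neqAle eq_sym q1 size_poly_gt0.
Qed.

End MonicIrreducible.

Section EulerProduct.
Variables (F : finFieldType) (P : {poly F}) (R : nzRingType).
Variable e : {poly F} -> R.
Hypothesis e1 : e 1 = 1.
Hypothesis eM : forall a b, a \is monic -> b \is monic ->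
  ~~ (P %| a) -> ~~ (P %| b) -> e (a * b) = e a * e b.

Variable k : nat.

Let factor (Q : {poly F}) : {poly R} :=
  \sum_(j < k.+1) (e Q ^+ j)%:P * 'X^(j * (size Q).-1).

Let avoids (t : seq {poly F}) (a : {poly F}) := all (fun Q => ~~ (Q %| a)) t.

(** [factor Q] inverts 1 - e(Q) X^(deg Q) up to an error of degree (k + 1) deg Q, which exceeds k
    and is invisible in the coefficients considered. *)
Let coef_factorM (Q : {poly F}) (r : {poly R}) m :
    (1 < size Q)%N -> (m <= k)%N ->
  (factor Q * r)`_m = r`_m +
  (if ((size Q).-1 <= m)%N then e Q * (factor Q * r)`_(m - (size Q).-1) else 0).
Proof.
move=> sQ mk; set f := factor Q; set dg := (size Q).-1.
have dg0 : (0 < dg)%N by rewrite /dg -ltnS prednK // ltnW.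
have E : f + (e Q ^+ k.+1)%:P * 'X^(k.+1 * dg) = 1 + ((e Q)%:P * 'X^dg) * f.
  transitivity (\sum_(j < k.+2) (e Q ^+ j)%:P * 'X^(j * dg)).
    by rewrite [RHS]big_ord_recr.
  rewrite big_ord_recl /= expr0 mul0n mulr1 mulr_sumr; congr (_ + _).
  apply: eq_bigr => j _; rewrite exprS polyCM -!mulrA; congr (_ * _).
  by rewrite mulrA -commr_polyXn -mulrA -exprD mulSn.
have fr : f * r = r + ((e Q)%:P * 'X^dg) * (f * r)
    - (e Q ^+ k.+1)%:P * ('X^(k.+1 * dg) * r).
  by apply/eqP; rewrite -subr_eq opprK !mulrA -mulrDl E mulrDl mul1r.
rewrite [in LHS]fr coefB coefD -!mulrA !coefCM !coefXnM.
have -> : (m < k.+1 * dg)%N by rewrite (leq_trans (_ : m < k.+1)%N) //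
  leq_pmulr.
rewrite mulr0 subr0; by case: ltnP => // _; rewrite mulr0.
Qed.

(* By induction on s, moving the primes from s to t.  Both sides satisfy
   c_m = r_m + e(Q) * c_(m - deg Q) when Q moves: on the right, the terms with
   Q | a are reindexed by a = Q * b. *)
Lemma euler_product_coef (s t : seq {poly F}) :
    uniq s -> {in s, forall Q, monic_irreducible Q} ->
    {in t, forall Q, monic_irreducible Q} ->
    P \in t -> {in s, forall Q, Q \notin t} ->
    (forall Q, monic_irreducible Q -> (size Q <= k.+1)%N ->
       (Q \in s) || (Q \in t)) ->
  forall m, (m <= k)%N ->
  (\prod_(Q <- s) factor Q)`_m =
    \sum_(a : {poly_k.+1 F} | monic_deg m a && avoids t a) e a.
Proof.
elim: s t => [|Q s IHs] t us si ti Pt st full m mk.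
  (* With s empty, t contains every monic irreducible of degree at most k, so a = 1 is the only
     polynomial that avoids t. *)
  rewrite big_nil coef1; case: m mk => [|m] mk /=.
    rewrite (bigD1 (npolyp k.+1 1)) /=; last first.
      rewrite npolypK ?size_poly1 // /monic_deg monic1 size_poly1 eqxx /=.
      apply/allP => Q /ti /andP[_ /irreducibleP[sQ _]].
      by rewrite dvdp1 gtn_eqF.
    rewrite npolypK ?size_poly1 // e1 big1 ?addr0 // =>
      a /andP[/andP[/andP[am]]].
    move=> /size_poly1P[c c0 ac] _ /negP[]; apply/eqP/val_inj.
    rewrite /= npolypK ?size_poly1 // ac.
    by move: am; rewrite ac monicE lead_coefC => /eqP->.
  rewrite big_pred0 // => a; apply/negP => /andP[/andP[am /eqP sa] /allP av].
  have [|Q Qi Qa] := @exists_monic_irreducible_dvdp F a; first by rewrite sa.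
  have := full Q Qi; rewrite (leq_trans _ (size_npoly a)); last first.
    by rewrite dvdp_leq // monic_neq0.
  by move=> /(_ isT) /av; rewrite Qa.
have Qi : monic_irreducible Q by apply: si; rewrite mem_head.
have /andP[Qm /irreducibleP[sQ _]] := Qi.
have Qt : Q \notin t by apply: st; rewrite mem_head.
have PQ : ~~ (P %| Q).
  by rewrite monic_irreducible_dvdp // ?ti //; apply: contraNneq Qt => <-.
have /andP[Qs us'] := us.
have {}IH : forall m, (m <= k)%N -> (\prod_(Q <- s) factor Q)`_m =
    \sum_(a : {poly_k.+1 F} | monic_deg m a && avoids (Q :: t) a) e a.
  apply: IHs => //.
  - by move=> T Ts; apply: si; rewrite inE Ts orbT.
  - by move=> T; rewrite inE => /predU1P[-> | /ti].
  - by rewrite inE Pt orbT.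
  - move=> T Ts; rewrite inE negb_or st ?inE ?Ts ?orbT // andbT.
    by apply: contraNneq Qs => <-.
  - by move=> T Ti /(full T Ti); rewrite !inE; case: (T == Q); rewrite ?orbT.
(* The recursion for Q refers to the same product in degree m - deg Q, hence a second induction, on
   the degree. *)
have [n] := ubnP m; elim: n m mk => // n IHn m mk mn.
have fE : factor Q * \prod_(T <- s) factor T = \prod_(T <- Q :: s) factor T.
  by rewrite big_cons.
rewrite big_cons coef_factorM // IH // fE.
rewrite [RHS](bigID (fun a : {poly_k.+1 F} => Q %| a)) /= [RHS]addrC.
congr (_ + _).
  by apply: eq_bigl => a; rewrite -andbA; congr (_ && _); rewrite andbC.
under [RHS]eq_bigl do rewrite andbAC.
rewrite big_mkcondr /=.
rewrite (@big_monic_deg_dvdp _ _ m k.+1 (size Q).-1 Q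
  (fun a => if avoids t a then e a else 0)) //; last first.
  by rewrite /monic_deg Qm prednK ?eqxx //; exact: ltnW.
case: leqP => // dm; rewrite IHn; last first.
- rewrite (leq_trans _ (ltnSE mn)) // ltn_subrL.
  by case: (size Q) sQ dm => [|[|?]] // _; case: m {mk mn}.
- by rewrite (leq_trans (leq_subr _ _)).
rewrite mulr_sumr big_mkcondr; apply: eq_bigr => a /andP[am _].
have -> : avoids t (Q * a) = avoids t a.
  apply: eq_in_all => T Tt; rewrite (monic_irreducible_dvdpM _ _ (ti _ Tt)).
  rewrite (monic_irreducible_dvdp (ti _ Tt) Qi).
  by case: eqP => // TQ; move: Qt; rewrite -TQ Tt.
case: ifPn => // ta; have Pa := allP ta _ Pt.
by rewrite eM.
Qed.

End EulerProduct.

(** * The Carlitz module *)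

Section CarlitzCoefficients.
Variable F : finFieldType.
Local Notation q := #|F|.
Implicit Types a b Q : {poly F}.

Lemma pnat_card_finField (R : comNzRingType) (f : {rmorphism F -> R}) i :
  [pchar R]%R.-nat (q ^ i)%N.
Proof.
have [p p_pr pF] := finPcharP F.
rewrite (card_pprimeChar pF) -expnM pnatX; apply/orP; left.
rewrite (eq_pnat p (pcharf_eq (rmorph_pchar f pF))); exact: pnat_id.
Qed.

Lemma exprD_card (R : comNzRingType) (f : {rmorphism F -> R}) i (x y : R) :
  (x + y) ^+ (q ^ i) = x ^+ (q ^ i) + y ^+ (q ^ i).
Proof. exact/exprDn_pchar/pnat_card_finField. Qed.

Lemma expr_sum_card (R : comNzRingType) (f : {rmorphism F -> R}) i
    (I : Type) (r : seq I) (P : pred I) (G : I -> R) :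
  (\sum_(x <- r | P x) G x) ^+ (q ^ i) = \sum_(x <- r | P x) G x ^+ (q ^ i).
Proof.
apply: (big_morph (fun x : R => x ^+ (q ^ i))); first exact: exprD_card f _.
by rewrite expr0n expn_eq0 gtn_eqF // ltnW // finNzRing_gt1.
Qed.

Lemma expf_card_pow (c : F) i : c ^+ (q ^ i) = c.
Proof. by elim: i => [|i IHi]; rewrite ?expr1 // expnS exprM expf_card. Qed.

Lemma polyC_expf_card (c : F) i : c%:P ^+ (q ^ i) = c%:P.
Proof. by rewrite -polyC_exp expf_card_pow. Qed.

Lemma dvdp_XqX_sub i a :
  'X^(q ^ i) - 'X %| a ^+ (q ^ i) - a.
Proof.
elim/poly_ind: a => [|a c IHa].
  by rewrite expr0n expn_eq0 (gtn_eqF (ltnW (finNzRing_gt1 F))) subr0 dvdp0.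
rewrite (exprD_card polyC) polyC_expf_card exprMn.
rewrite [X in _ %| X](_ : _ = (a ^+ (q ^ i) - a) * 'X^(q ^ i) + a * ('X^(q ^ i)
  - 'X)).
  by apply: dvdp_add; [exact: dvdp_mulr | exact: dvdp_mull].
by rewrite opprD addrACA subrr addr0 mulrBl mulrBr addrA subrK.
Qed.

Lemma in_qpoly_eq0 Q a : monic_irreducible Q ->
  in_qpoly Q a = 0 <-> Q %| a.
Proof.
move=> /andP[Qm /irreducibleP [sQ _]].
have E : val (in_qpoly Q a) = a %% Q.
  by rewrite /= /mk_monic sQ Qm -Pdiv.IdomainMonic.modpE.
by split=> [a0 | /modp_eq0P a0]; [apply/modp_eq0P;
  rewrite -E a0 | apply/val_inj; rewrite E].
Qed.

(** Otherwise every element of the field A / Q, of order q^(deg Q), would be a root of a nonzero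
    polynomial of smaller degree q^i. *)
Lemma not_dvdp_XqX_sub Q i : monic_irreducible Q -> (0 < i < (size Q).-1)%N ->
  ~~ (Q %| 'X^(q ^ i) - 'X).
Proof.
move=> Qmi /andP[i0 iQ]; apply/negP => QX;
  have /andP[Qm /irreducibleP Qi] := Qmi.
have hI : monic_irreducible_poly Q by [].
pose E := {poly %/ Q with hI}.
have q1 : (1 < q ^ i)%N by rewrite -(exp1n i) ltn_exp2r // finNzRing_gt1.
have sX : size ('X^(q ^ i) - 'X : {poly E}) = (q ^ i).+1.
  by rewrite size_polyDl size_polyXn // size_polyN size_polyX ltnS.
have X0 : ('X^(q ^ i) - 'X : {poly E}) != 0 by rewrite -size_poly_gt0 sX.
have := max_poly_roots X0 (rs := enum E).
rewrite enum_uniq -cardE sX card_qfpoly ltnS leq_exp2l ?finNzRing_gt1 //.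
rewrite leqNgt iQ => H;
  suff /H/(_ isT) : all (root ('X^(q ^ i) - 'X)) (enum E) by [].
apply/allP => x _; rewrite rootE !hornerE subr_eq0; apply/eqP.
have -> : x = in_qpoly Q (val x) :> {poly %/ Q}.
  by apply/val_inj/esym/in_qpoly_small; exact: size_mk_monic.
apply/eqP; rewrite -subr_eq0 -[X in X == _]/((in_qpoly Q (val x)) ^+ (q ^ i) -
  in_qpoly Q (val x) : {poly %/ Q}).
rewrite -rmorphXn -rmorphB; apply/eqP/(in_qpoly_eq0 _ Qmi).
exact: dvdp_trans QX (dvdp_XqX_sub _ _).
Qed.

(* [carlitz_coefX l i] is the coefficient of tau^i in (theta + tau)^l. *)
Fixpoint carlitz_coefX (l i : nat) : {poly F} :=
  if l is l'.+1 then
    'X^(q ^ i) * carlitz_coefX l' i + (if i is i'.+1 then carlitz_coefX l' i'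
      else 0)
  else (i == 0)%:R.

Lemma carlitz_coefXS l i : carlitz_coefX l.+1 i =
  'X^(q ^ i) * carlitz_coefX l i + (if i is i'.+1 then carlitz_coefX l i' else
    0).
Proof. by []. Qed.

(** The definition multiplies (theta + tau)^l by theta + tau on the right; this is multiplication on
    the left. Comparing the two yields [carlitz_coef_rec]. *)
Lemma carlitz_coefXSl l i : carlitz_coefX l.+1 i =
  'X * carlitz_coefX l i + (if i is i'.+1 then carlitz_coefX l i' ^+ q else 0).
Proof.
elim: l i => [|l IHl] i.
  rewrite /=; case: i => [|[|i]] /=; rewrite ?mulr0 ?expr1n ?expn0 //.
  by rewrite expr0n (gtn_eqF (ltnW (finNzRing_gt1 F))).
rewrite carlitz_coefXS; case: i => [|i]; first by rewrite expn0 expr1.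
rewrite [in X in X + _]IHl [in X in _ + X]IHl.
rewrite [in X in _ = X + _]carlitz_coefXS [in X in _ = _ + X]carlitz_coefXS.
have := @exprD_card _ polyC 1; rewrite expn1 => ->.
rewrite !mulrDr mulrCA -!addrA; congr (_ + _); rewrite addrCA; congr (_ + _).
rewrite exprMn -exprM -expnSr; congr (_ + _).
by case: i => //; rewrite expr0n (gtn_eqF (ltnW (finNzRing_gt1 F))).
Qed.

Lemma carlitz_coefX_eq0 l i : (l < i)%N -> carlitz_coefX l i = 0.
Proof.
elim: l i => [|l IHl] [|i] //= li.
by rewrite !IHl ?mulr0 ?addr0 // ltnW.
Qed.

Lemma carlitz_coefX_diag l : carlitz_coefX l l = 1.
Proof.
by elim: l => //= l IHl; rewrite IHl carlitz_coefX_eq0 ?mulr0 ?add0r.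
Qed.

Lemma carlitz_coefX0 l : carlitz_coefX l 0 = 'X^l.
Proof. by elim: l => //= l ->; rewrite addr0 expn0 -exprS. Qed.

(* The coefficient of tau^i in Phi_a. *)
Definition carlitz_coef a i : {poly F} :=
  \sum_(l < size a) a`_l *: carlitz_coefX l i.

Lemma carlitz_coef0 a : carlitz_coef a 0 = a.
Proof.
rewrite -[RHS]coefK poly_def; apply: eq_bigr => l _.
by rewrite carlitz_coefX0.
Qed.

Lemma carlitz_coef_lead a : a != 0 -> carlitz_coef a (size a).-1 = (lead_coef
  a)%:P.
Proof.
rewrite -size_poly_gt0 /carlitz_coef lead_coefE; case: (size a) => // n _ /=.
rewrite big_ord_recr big1 /= => [|l _];
  last by rewrite carlitz_coefX_eq0 ?scaler0.
by rewrite carlitz_coefX_diag add0r alg_polyC.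
Qed.

(* Both sides compute the coefficient of tau^(i+1) in the commutator of Phi_a
   and Phi_theta. *)
Lemma carlitz_coef_rec a i :
  ('X^(q ^ i.+1) - 'X) * carlitz_coef a i.+1 = carlitz_coef a i ^+ q -
    carlitz_coef a i.
Proof.
apply/eqP; rewrite mulrBl subr_eq addrAC [X in _ == X - _]addrC eq_sym subr_eq;
  apply/eqP.
rewrite /carlitz_coef; have := @expr_sum_card _ polyC 1; rewrite expn1 => ->.
rewrite !mulr_sumr -!big_split /=; apply: eq_bigr => l _.
have := carlitz_coefXSl l i.+1; rewrite carlitz_coefXS => E.
by rewrite exprZn expf_card -!scalerAr -!scalerDr E.
Qed.

(** That is, Phi_Q = tau^(deg Q) modulo Q, the reason why Frobenius acts as Phi_Q. The recursion
    gives each coefficient from the preceding one, and its factor X^(q^i) - X is prime to Q in this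
    range. *)
Lemma dvdp_carlitz_coef Q i : monic_irreducible Q -> (i < (size Q).-1)%N ->
  Q %| carlitz_coef Q i.
Proof.
move=> Qmi; elim: i => [|i IHi] iQ; first by rewrite carlitz_coef0.
have QX : ~~ (Q %| 'X^(q ^ i.+1) - 'X) by apply: not_dvdp_XqX_sub.
suff : Q %| ('X^(q ^ i.+1) - 'X) * carlitz_coef Q i.+1.
  by rewrite monic_irreducible_dvdpM // (negPf QX).
rewrite carlitz_coef_rec dvdp_sub ?IHi ?(ltnW iQ) //.
rewrite -(prednK (ltnW (finNzRing_gt1 F))) exprS dvdp_mulr ?IHi // ltnW //.
Qed.

End CarlitzCoefficients.

(** * Primes above a prime of A *)

Section LyingOver.
Variables (F : finFieldType) (L : fieldType) (f : {rmorphism {poly F} -> L}).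
Hypothesis f_inj : injective f.
Implicit Types (a b Q : {poly F}) (x y z : L).

Local Notation integral := (integralOver f).

(** Multiplying a monic equation of degree n for 1 / a by a^n turns its leading term into 1 and all
    others into multiples of a. *)
Lemma integral_invr_rmorph a : a != 0 -> integral (f a)^-1 -> a %| 1.
Proof.
move=> a0 [p pm /rootP pa].
have fa0 : f a != 0 by rewrite -(rmorph0 f) (inj_eq f_inj).
have p0 : (0 < size p)%N by rewrite size_poly_gt0 monic_neq0.
have [n sp] : exists n, size p = n.+1 by case: (size p) p0 => // n; exists n.
have E : \sum_(i < n.+1) p`_i * a ^+ (n - i) = 0.
  apply: f_inj; rewrite rmorph_sum rmorph0 /= -[RHS](mulr0 (f a ^+ n)) -[X in _
    = _ * X]pa.
  rewrite (@horner_coef_wide _ n.+1) -?sp ?size_poly // sp.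
  rewrite mulr_sumr; apply: eq_bigr => i _.
  have ni : (i <= n)%N by rewrite -ltnS.
  by rewrite coef_map rmorphM rmorphXn (exprB ni) ?unitfE // mulrCA exprVn.
move: E; rewrite big_ord_recr /= subnn mulr1.
have := monicP pm; rewrite lead_coefE sp /= => -> /eqP.
rewrite addrC addr_eq0 => /eqP ->; rewrite dvdpNr;
  apply: (big_ind (fun b => a %| b)) => [|u v|i _].
- exact: dvdp0.
- exact: dvdp_add.
by rewrite dvdp_mull // dvdp_exp ?subn_gt0.
Qed.

Section PrimeAbove.
Variable Q : {poly F}.
Hypothesis Q_irr : monic_irreducible Q.

Let proper_ideal (I : set L) := [/\ (forall x, I x -> integral x),
  (forall x y, I x -> I y -> I (x + y)),
  (forall z x, integral z -> I x -> I (z * x)),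
  I (f Q) & ~ I 1].

Let extend (I : set L) x : set L :=
  [set y | exists u z, [/\ I u, integral z & y = u + z * x]]%classic.

(** The element f Q is required in the extension and not in I, so that the lemma covers the zero
    ideal extended by f Q as well as the maximal ideal. *)
Let extend_proper I x : I 0 -> (forall y, I y -> integral y) ->
  (forall y z, I y -> I z -> I (y + z)) ->
  (forall z y, integral z -> I y -> I (z * y)) -> integral x ->
  extend I x (f Q) -> ~ extend I x 1 -> proper_ideal (extend I x).
Proof.
move=> I0 Ii ID IM xi xQ x1; split=> //.
- by move=> _ [a [z [aI zi ->]]]; apply: integral_add;
  [exact: Ii | exact: integral_mul].
- move=> _ _ [a [z [aI zi ->]]] [a' [z' [aI' zi' ->]]].
  exists (a + a'), (z + z'); split; first exact: ID; first exact: integral_add.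
  by rewrite mulrDl addrACA.
move=> w _ wi [a [z [aI zi ->]]]; exists (w * a), (w * z); split.
- exact: IM.
- exact: integral_mul.
by rewrite mulrDr mulrA.
Qed.

(* A maximal proper ideal containing Q; one exists because Q^-1 is not
   integral.  The predicate fed to Zorn's lemma also accepts the empty set, so
   as to cover the empty chain. *)
Lemma exists_prime_over : exists I : set L,
  [/\ forall x, I x -> integral x, I 0,
      forall x y, I x -> I y -> I (x + y) &
      forall z x, integral z -> I x -> I (z * x)] /\
  [/\ ~ I 1, forall x y, integral x -> integral y -> I (x * y) -> I x \/ I y &
      forall a, I (f a) <-> Q %| a].
Proof.
have /andP[Qm /irreducibleP[sQ _]] := Q_irr.
have Q0 : Q != 0 by rewrite monic_neq0.
have Qi : integral (f Q) by exact: integral_id.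
pose P := [set I : set L | forall x, I x -> proper_ideal I]%classic.
have [C CP Ctot|I [IP Imax]] := @Zorn_bigcup L P.
  move=> x [I0 CI0 I0x]; split.
  - by move=> y [I CI Iy]; have [Ii _ _ _ _] := CP _ CI _ Iy; exact: Ii.
  - move=> y z [I CI Iy] [J CJ Jz]; have [IJ | JI] := Ctot _ _ CI CJ.
      by exists J => //; have [_ JD _ _ _] := CP _ CJ _ Jz; apply: JD => //;
        exact: IJ.
    by exists I => //; have [_ ID _ _ _] := CP _ CI _ Iy; apply: ID => //;
      exact: JI.
  - move=> z y zi [I CI Iy]; exists I => //.
    by have [_ _ IM _ _] := CP _ CI _ Iy; exact: IM.
  - by exists I0 => //; have [_ _ _ QI _] := CP _ CI0 _ I0x.
  - by move=> [I CI I1]; have [_ _ _ _] := CP _ CI _ I1.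
(* The maximal set is not the empty one, since the ideal generated by Q is proper and larger. *)
have [x Ix] : exists x, I x.
  apply: contrapT => I0; pose J := extend [set 0]%classic (f Q).
  have JQ : J (f Q) by exists 0, 1; split=> //;
    [exact: integral1 | rewrite add0r mul1r].
  apply: (Imax J).
    by split=> [y Iy | JI]; [case: I0; exists y | case: I0; exists (f Q);
      exact: JI].
  move=> _ _; apply: extend_proper => //.
  - by move=> _ ->; exact: integral0.
  - by move=> _ _ -> ->; exact: addr0.
  - by move=> z _ _ ->; exact: mulr0.
  move=> [a [z [-> zi]]]; rewrite add0r => E.
  have : Q %| 1.
    apply: integral_invr_rmorph => //; rewrite -[_^-1]mul1r E mulfK //.
    by rewrite -(rmorph0 f) (inj_eq f_inj).
  by rewrite dvdp1 gtn_eqF.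
have [Ii ID IM IQ I1] := IP _ Ix.
have I0 : I 0 by rewrite -(mul0r x); apply: IM => //; exact: integral0.
exists I; split; split=> //.
(* If y is not in I, maximality gives 1 = a + w y with a in I, whence z = a z + w (y z) lies in
   I. *)
- move=> y z yi zi Iyz; have [Iy | Iy] := pselect (I y); [by left | right].
  have [a [w [aI wi E]]] : extend I y 1.
    apply: contrapT => H; apply: (Imax (extend I y)).
      split=> [v Iv | EI]; first by exists v, 0; split=> //;
        [exact: integral0 | rewrite mul0r addr0].
      by apply/Iy/EI; exists 0, 1; split=> //;
        [exact: integral1 | rewrite add0r mul1r].
    move=> _ _; apply: extend_proper => //.
    by exists (f Q), 0; split=> //; [exact: integral0 | rewrite mul0r addr0].
  rewrite -[z]mul1r E mulrDl; apply: ID; first by rewrite mulrC; exact: IM.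
  by rewrite -mulrA; exact: IM.
move=> a; split=> [Ia | /dvdpP[b ->]]; last first.
  by rewrite rmorphM; apply: IM => //; exact: integral_id.
apply: contrapT => /negP Qa; apply: I1.
have /Bezout_eq1_coprimepP[[u v] /= E] : coprimep Q a.
  by rewrite irreducible_poly_coprime //; have /andP[_ /irreducibleP] := Q_irr.
rewrite -(rmorph1 f) -E rmorphD !rmorphM.
by apply: ID; apply: IM => //; exact: integral_id.
Qed.

End PrimeAbove.
End LyingOver.

(** * Torsion of the Carlitz module *)

Section CarlitzAction.
Variables (F : finFieldType) (L : fieldType) (f : {rmorphism {poly F} -> L}).
Hypothesis f_inj : injective f.
Local Notation q := #|F|.
Implicit Types (a b : {poly F}) (x y : L).

Let q_gt1 : (1 < q)%N := finNzRing_gt1 F.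

Lemma expr_card_add i x y : (x + y) ^+ (q ^ i) = x ^+ (q ^ i) + y ^+ (q ^ i).
Proof. exact: (@exprD_card _ _ (f \o polyC)). Qed.

Definition carlitz_theta x : L := f 'X * x + x ^+ q.

(** Phi_a(x) through iterates of Phi_theta: the module laws are formal in this shape, whereas
    [carlitz_poly] shows the coefficients needed for degrees, separability and congruences. *)
Definition carlitz_act a x : L :=
  \sum_(l < size a) f (a`_l)%:P * iter l carlitz_theta x.

Definition carlitz_poly a : {poly L} :=
  \sum_(i < size a) f (carlitz_coef a i) *: 'X^(q ^ i).

Lemma carlitz_thetaD : {morph carlitz_theta : x y / x + y}.
Proof.
move=> x y; rewrite /carlitz_theta mulrDr.
by have := expr_card_add 1 x y; rewrite expn1 => ->; rewrite addrACA.
Qed.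

Lemma carlitz_thetaZ c x : carlitz_theta (f c%:P * x) = f c%:P * carlitz_theta
  x.
Proof.
rewrite /carlitz_theta mulrDr exprMn -rmorphXn /= -polyC_exp expf_card.
by rewrite mulrCA.
Qed.

Lemma carlitz_theta0 : carlitz_theta 0 = 0.
Proof. by rewrite /carlitz_theta mulr0 add0r expr0n gtn_eqF // ltnW. Qed.

Lemma carlitz_act_wide n a x : (size a <= n)%N ->
  carlitz_act a x = \sum_(l < n) f (a`_l)%:P * iter l carlitz_theta x.
Proof.
move=> an; rewrite /carlitz_act (big_ord_widen _ (fun l =>
  f (a`_l)%:P * iter l carlitz_theta x) an).
rewrite big_mkcond; apply: eq_bigr => l _; case: ltnP => // al.
by rewrite nth_default // rmorph0 mul0r.
Qed.

Lemma carlitz_actDl a b x : carlitz_act (a + b) x = carlitz_act a x +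
  carlitz_act b x.
Proof.
rewrite (@carlitz_act_wide (maxn (size a) (size b)) a) ?leq_maxl //.
rewrite (@carlitz_act_wide (maxn (size a) (size b)) b) ?leq_maxr //.
rewrite (@carlitz_act_wide (maxn (size a) (size b)) (a + b)) ?size_polyD //.
by rewrite -big_split; apply: eq_bigr => l _;
  rewrite coefD polyCD rmorphD mulrDl.
Qed.

Lemma carlitz_actC c x : carlitz_act c%:P x = f c%:P * x.
Proof. by rewrite (@carlitz_act_wide 1) ?size_polyC_leq1 // big_ord1 coefC. Qed.

Lemma carlitz_act0 x : carlitz_act 0 x = 0.
Proof. by rewrite carlitz_actC rmorph0 mul0r. Qed.

Lemma carlitz_act1 x : carlitz_act 1 x = x.
Proof. by rewrite carlitz_actC rmorph1 mul1r. Qed.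

Lemma carlitz_actNl a x : carlitz_act (- a) x = - carlitz_act a x.
Proof. by apply/eqP; rewrite -addr_eq0 -carlitz_actDl addNr carlitz_act0. Qed.

Lemma carlitz_act_mulX a x : carlitz_act (a * 'X) x = carlitz_act a
  (carlitz_theta x).
Proof.
rewrite (@carlitz_act_wide (size a).+1) ?size_mulX_leq //; last first.
  by rewrite (leq_trans (size_polyMleq _ _)) // size_polyX addn2.
rewrite big_ord_recl coefMX rmorph0 mul0r add0r.
by apply: eq_bigr => l _; rewrite coefMX lift0 /= -iterSr.
Qed.

Lemma carlitz_act_theta a x : carlitz_act (a * 'X) x = carlitz_theta
  (carlitz_act a x).
Proof.
rewrite carlitz_act_mulX /carlitz_act.
rewrite (big_morph carlitz_theta carlitz_thetaD carlitz_theta0).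
by apply: eq_bigr => l _; rewrite carlitz_thetaZ -iterS -iterSr.
Qed.

Lemma carlitz_actZ c a x : carlitz_act (c%:P * a) x = f c%:P * carlitz_act a x.
Proof.
rewrite (@carlitz_act_wide (size a)) ?mulr_sumr; last first.
  by rewrite mul_polyC size_scale_leq.
by apply: eq_bigr => l _; rewrite coefCM polyCM rmorphM mulrA.
Qed.

Lemma carlitz_actM a b x : carlitz_act (a * b) x = carlitz_act a (carlitz_act b
  x).
Proof.
elim/poly_ind: a b x => [|a c IHa] b x; first by rewrite mul0r !carlitz_act0.
rewrite mulrDl -mulrA ['X * b]mulrC 2!carlitz_actDl IHa carlitz_actC.
by rewrite carlitz_actZ carlitz_act_mulX carlitz_act_theta.
Qed.

Lemma carlitz_act_comm a b x :
  carlitz_act a (carlitz_act b x) = carlitz_act b (carlitz_act a x).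
Proof. by rewrite -!carlitz_actM mulrC. Qed.

Lemma iter_carlitz_poly l (g : {poly L} -> {poly L}) :
  (forall r, g r = f 'X *: r + r ^+ q) ->
  iter l g 'X = \sum_(i < l.+1) f (carlitz_coefX F l i) *: 'X^(q ^ i).
Proof.
move=> gE; elim: l => [|l IHl].
  by rewrite big_ord1 /= rmorph1 scale1r.
rewrite iterS IHl gE; have := @expr_sum_card F _ (polyC \o f \o polyC) 1;
  rewrite expn1 => ->.
rewrite [RHS](eq_bigr (fun i : 'I__ =>
    f 'X *: (f (carlitz_coefX F l i) *: 'X^(q ^ i)) +
    (if i : nat is i'.+1 then f (carlitz_coefX F l i') ^+ q else 0) *: 'X^(q ^
      i))); last first.
  move=> i _; rewrite carlitz_coefXSl rmorphD rmorphM scalerDl scalerA.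
  by case: (i : nat) => [|i']; rewrite ?rmorph0 ?rmorphXn.
rewrite big_split /=; congr (_ + _).
  by rewrite scaler_sumr [RHS]big_ord_recr /= carlitz_coefX_eq0 //
    rmorph0 scale0r scaler0 addr0.
rewrite [RHS]big_ord_recl /= scale0r add0r; apply: eq_bigr => i _.
by rewrite exprZn -exprM -expnSr.
Qed.

Lemma carlitz_polyE a (g : {poly L} -> {poly L}) :
  (forall r, g r = f 'X *: r + r ^+ q) ->
  carlitz_poly a = \sum_(l < size a) f (a`_l)%:P *: iter l g 'X.
Proof.
move=> gE; rewrite /carlitz_poly /carlitz_coef.
transitivity (\sum_(l < size a) \sum_(i < size a) (f (a`_l *: carlitz_coefX F l
  i) *: 'X^(q ^ i))).
  rewrite exchange_big; apply: eq_bigr => i _.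
  by rewrite rmorph_sum scaler_suml.
apply: eq_bigr => l _; rewrite (iter_carlitz_poly _ gE) scaler_sumr.
rewrite (big_ord_widen (size a) (fun i =>
  f (a`_l)%:P *: (f (carlitz_coefX F l i) *: 'X^(q ^ i)))) //.
rewrite [RHS]big_mkcond; apply: eq_bigr => i _.
rewrite -mul_polyC rmorphM scalerA; case: ltnP => // li.
by rewrite carlitz_coefX_eq0 // rmorph0 mulr0 scale0r.
Qed.

Lemma horner_carlitz_poly a x : (carlitz_poly a).[x] = carlitz_act a x.
Proof.
rewrite (carlitz_polyE a (g := fun r => f 'X *: r + r ^+ q)) // horner_sum.
apply: eq_bigr => l _; rewrite hornerZ; congr (_ * _).
elim: (l : nat) => [|n IHn]; first by rewrite hornerX.
by rewrite !iterS hornerD hornerZ horner_exp IHn.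
Qed.

Lemma carlitz_actE a x :
  carlitz_act a x = \sum_(i < size a) f (carlitz_coef a i) * x ^+ (q ^ i).
Proof.
by rewrite -horner_carlitz_poly horner_sum; apply: eq_bigr => i _;
  rewrite hornerZ hornerXn.
Qed.

Lemma carlitz_actDr a x y : carlitz_act a (x + y) = carlitz_act a x +
  carlitz_act a y.
Proof.
by rewrite !carlitz_actE -big_split; apply: eq_bigr => i _;
  rewrite expr_card_add mulrDr.
Qed.

Lemma carlitz_act_r0 a : carlitz_act a 0 = 0.
Proof. by apply: (addrI (carlitz_act a 0)); rewrite -carlitz_actDr !addr0. Qed.

Lemma carlitz_actBr a x y : carlitz_act a (x - y) = carlitz_act a x -
  carlitz_act a y.
Proof. by apply/eqP; rewrite eq_sym subr_eq -carlitz_actDr subrK. Qed.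

Lemma size_carlitz_poly a : a != 0 ->
  size (carlitz_poly a) = (q ^ (size a).-1).+1 /\
  lead_coef (carlitz_poly a) = f (lead_coef a)%:P.
Proof.
move=> a0; have := carlitz_coef_lead a0; rewrite /carlitz_poly.
move: (a0); rewrite -size_poly_gt0; case E: (size a) => [|n] // _ /= cl.
rewrite big_ord_recr /= cl.
have la : f (lead_coef a)%:P != 0.
  by rewrite -(rmorph0 f) (inj_eq f_inj) polyC_eq0 lead_coef_eq0.
have sl : (size (\sum_(i < n) f (carlitz_coef a i) *: 'X^(q ^ i) : {poly L})%R
    < size (f (lead_coef a)%:P *: 'X^(q ^ n) : {poly L})%R)%N.
  rewrite size_scale // size_polyXn ltnS; apply: leq_trans (size_sum _ _ _) _.
  apply/bigmax_leqP => i _; apply: leq_trans (size_scale_leq _ _) _.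
  by rewrite size_polyXn ltn_exp2l.
by rewrite addrC size_polyDl // lead_coefDl //
  lead_coefZ lead_coefXn mulr1 size_scale // size_polyXn.
Qed.

Lemma carlitz_poly_neq0 a : a != 0 -> carlitz_poly a != 0.
Proof. by move=> /size_carlitz_poly[s _]; rewrite -size_poly_gt0 s. Qed.

Lemma deriv_carlitz_poly a : (carlitz_poly a)^`() = (f a)%:P.
Proof.
rewrite /carlitz_poly; have [->|a0] := eqVneq a 0.
  by rewrite size_poly0 big_ord0 deriv0 rmorph0.
move: (a0); rewrite -size_poly_gt0; case: (size a) => // n _.
rewrite big_ord_recl /= carlitz_coef0 derivD [X in _ + X]raddf_sum expn0 expr1
  derivZ derivX.
rewrite big1 ?addr0 ?alg_polyC // => i _.
rewrite /= derivZ derivXn /bump leq0n add1n expnS mulrnA -[_ *+ q]mulr_natr.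
have -> : q%:R = 0 :> {poly L}.
  by rewrite -(rmorph_nat (polyC \o f \o polyC)) natr_card_finField rmorph0.
by rewrite mulr0 mul0rn scaler0.
Qed.

Lemma separable_carlitz_poly a : a != 0 -> separable_poly (carlitz_poly a).
Proof.
move=> a0; rewrite separable_poly.unlock deriv_carlitz_poly coprimep_sym
  -alg_polyC coprimepZl ?coprime1p //.
by rewrite -(rmorph0 f) (inj_eq f_inj).
Qed.

End CarlitzAction.

(** * The torsion is free of rank one over A / P^m, and Frobenius acts on it by Phi_Q *)

Section CarlitzTorsion.
Variables (F : finFieldType) (L : fieldType) (f : {rmorphism {poly F} -> L}).
Hypothesis f_inj : injective f.
Local Notation q := #|F|.
Local Notation act := (carlitz_act f).
Implicit Types (a b Q : {poly F}) (x y : L).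

Lemma size_carlitz_roots a (s : seq L) : a != 0 -> uniq s ->
  (forall x, x \in s -> act a x = 0) -> (size s <= q ^ (size a).-1)%N.
Proof.
move=> a0 us sa; have [sp _] := size_carlitz_poly f_inj a0.
have := max_poly_roots (carlitz_poly_neq0 f_inj a0) _ us; rewrite sp ltnS;
  apply.
by apply/allP => x /sa xa; rewrite rootE horner_carlitz_poly xa.
Qed.

Variables (P : {poly F}) (d m : nat).
Hypotheses (P_irr : monic_irreducible P) (P_deg : size P = d.+1) (m_gt0 : (0 <
  m)%N).

Definition carlitz_torsion x := act (P ^+ m) x = 0.

Let Pm : P \is monic. Proof. by case/andP: P_irr. Qed.
Let P0 k : P ^+ k != 0. Proof. by rewrite expf_neq0 // monic_neq0. Qed.
Let d_gt0 : (0 < d)%N.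
Proof. by case/andP: P_irr => _ /irreducibleP[]; rewrite P_deg. Qed.
Let sizeP k : (size (P ^+ k)).-1 = (d * k)%N.
Proof. by rewrite size_exp P_deg. Qed.

Lemma carlitz_torsion_act a x : carlitz_torsion x -> carlitz_torsion (act a x).
Proof. by rewrite /carlitz_torsion carlitz_act_comm => ->;
  exact: carlitz_act_r0. Qed.

Lemma dvdp_carlitz_act a x : carlitz_torsion x -> P ^+ m %| a -> act a x = 0.
Proof. by move=> tx /dvdpP[b ->]; rewrite carlitz_actM tx carlitz_act_r0. Qed.

Variable rs : seq L.
Hypothesis rs_split : carlitz_poly f (P ^+ m) %= \prod_(x <- rs) ('X - x%:P).

Lemma mem_torsion x : x \in rs <-> carlitz_torsion x.
Proof.
rewrite /carlitz_torsion -root_prod_XsubC -(eqp_root rs_split) rootE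
  horner_carlitz_poly.
by split=> /eqP.
Qed.

Lemma uniq_torsion : uniq rs.
Proof.
by rewrite -separable_prod_XsubC -(eqp_separable rs_split)
  separable_carlitz_poly.
Qed.

Lemma size_torsion : size rs = (q ^ (d * m))%N.
Proof.
have [sp _] := size_carlitz_poly f_inj (P0 m).
by have := eqp_size rs_split; rewrite size_prod_XsubC sp sizeP => -[].
Qed.

(** By counting roots, some torsion point l is not killed by P^(m-1). If a = b P^k kills l with k <
    m and b prime to P, then b is invertible modulo P^m, so P^k would kill l. *)
Lemma exists_torsion_generator : exists l, carlitz_torsion l /\
  forall a, act a l = 0 <-> P ^+ m %| a.
Proof.
have [l lrs lP] : exists2 l, l \in rs & act (P ^+ m.-1) l != 0.
  apply: contrapT => H;
    have := @size_carlitz_roots (P ^+ m.-1) rs (P0 _) uniq_torsion.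
  rewrite sizeP size_torsion leq_exp2l ?finNzRing_gt1 // leq_pmul2l //
    leqNgt prednK // leqnn.
  move=> C; have [] : ~ false by []; apply: C => x xr.
  by apply/eqP/negPn/negP => xP; apply: H; exists x.
have tl : carlitz_torsion l by apply/mem_torsion.
exists l; split=> // a; split; last exact: dvdp_carlitz_act.
move=> al; suff H k : (k <= m)%N -> P ^+ k %| a by exact: H.
elim: k => [|k IHk] km; first by rewrite expr0 dvd1p.
have /dvdpP[b ab] := IHk (ltnW km).
rewrite ab exprS dvdp_mul2r //; apply: contraNT lP => Pb.
have /Bezout_eq1_coprimepP[[u v] /= E] : coprimep b (P ^+ m).
  rewrite coprimep_sym coprimep_expl // irreducible_poly_coprime //.
  by case/andP: P_irr => _ /irreducibleP.
have lk : act (P ^+ k) l = 0.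
  rewrite -[act _ _](carlitz_act1 f) -E carlitz_actDl !carlitz_actM.
  by rewrite -(carlitz_actM _ b) -ab al (carlitz_torsion_act _ tl)
    !carlitz_act_r0 // addr0.
have kp : (k <= m.-1)%N by rewrite -ltnS prednK.
by rewrite -(subnK kp) exprD carlitz_actM lk carlitz_act_r0.
Qed.

(** The q^(d m) polynomials of degree below d m give distinct points Phi_b(l), as many as there are
    torsion points. *)
Lemma torsion_generated l x : (forall a, act a l = 0 <-> P ^+ m %| a) ->
  carlitz_torsion x -> exists a, x = act a l.
Proof.
move=> lP /mem_torsion xr.
pose s := [seq act (b : {poly F}) l | b : {poly_(d * m) F}].
have tl : carlitz_torsion l by apply/lP.
have us : uniq s.
  rewrite map_inj_uniq ?enum_uniq // => b c /eqP.
  rewrite -subr_eq0 -carlitz_actNl -carlitz_actDl => /eqP /lP bc.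
  apply/val_inj/eqP; rewrite -subr_eq0; apply: contraTT bc => bc.
  apply/negP => /dvdp_leq -/(_ bc); rewrite leqNgt => /negP; apply.
  rewrite -[size (P ^+ m)]prednK ?size_poly_gt0 // sizeP ltnS.
  rewrite (leq_trans (size_polyD _ _)) // size_polyN geq_max !size_npoly //.
have [||_ sE] := @uniq_min_size _ s rs us.
- by move=> _ /mapP[b _ ->]; apply/mem_torsion/carlitz_torsion_act.
- by rewrite size_torsion size_map -cardE card_npoly.
by move: xr; rewrite -sE => /mapP[b _ ->]; exists b.
Qed.

Section Frobenius.
Variables (Q : {poly F}) (I : L -> Prop) (s : L -> L).
Hypotheses (Q_irr : monic_irreducible Q) (QP : Q != P).
Hypotheses (I0 : I 0) (ID : forall x y, I x -> I y -> I (x + y)).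
Hypothesis IM : forall z x, integralOver f z -> I x -> I (z * x).
Hypothesis I_over : forall a, I (f a) <-> Q %| a.
Hypothesis s_torsion : forall x, carlitz_torsion x -> carlitz_torsion (s x).
Hypothesis s_frob : forall x, integralOver f x -> I (s x - x ^+ (q ^ (size
  Q).-1)).

Let integral_expr z n : integralOver f z -> integralOver f (z ^+ n).
Proof.
by move=> zi; elim: n => [|n IHn]; [exact: integral1 | rewrite exprS;
  exact: integral_mul].
Qed.

Let I_sum (r : seq nat) (G : nat -> L) : (forall i, i \in r -> I (G i)) ->
  I (\sum_(i <- r) G i).
Proof. by move=> H; rewrite big_seq; apply: big_ind. Qed.

Lemma integral_torsion x : carlitz_torsion x -> integralOver f x.
Proof.
move=> tx; have [sp lp] := size_carlitz_poly f_inj (P0 m).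
apply: (@integral_root_monic _ _ _ _ (carlitz_poly f (P ^+ m))).
- by rewrite monicE lp (monicP (monic_exp m Pm)) polyC1 rmorph1.
- by rewrite rootE horner_carlitz_poly tx.
apply/integral_poly => i; rewrite /carlitz_poly coef_sum; apply: big_ind.
- exact: integral0.
- by move=> u v; exact: integral_add.
move=> k _; rewrite coefZ coefXn mulr_natr mulrb; case: ifP => _;
  last exact: integral0.
exact: integral_id.
Qed.

(* A nonzero torsion point x divides P ^+ m, the constant term of
   Phi_(P ^+ m)(X) / X. *)
Let torsion_I x : carlitz_torsion x -> I x -> x = 0.
Proof.
move=> tx Ix; apply/eqP; apply: contraTT isT => x0.
have : Q %| P ^+ m.
  apply/I_over; have := tx; rewrite /carlitz_torsion carlitz_actE.
  rewrite -(prednK (_ : 0 < size (P ^+ m))%N) ?size_poly_gt0 //.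
  rewrite big_ord_recl carlitz_coef0 expn0 expr1 => E.
  have -> : f (P ^+ m) = - \sum_(i < (size (P ^+ m)).-1)
      f (carlitz_coef (P ^+ m) i.+1) * (x ^+ (q ^ i.+1).-1).
    apply: (mulIf x0); apply/eqP;
      rewrite mulNr -addr_eq0 -[X in _ == X]E mulr_suml.
    rewrite eq_sym; apply/eqP; congr (_ + _); apply: eq_bigr => i _.
    by rewrite lift0 -mulrA -exprSr prednK // expn_gt0 ltnW // finNzRing_gt1.
  rewrite -mulN1r; apply: IM; first by rewrite -(rmorphN1 f);
    exact: integral_id.
  rewrite -(big_mkord xpredT (fun i =>
    f (carlitz_coef (P ^+ m) i.+1) * x ^+ (q ^ i.+1).-1)).
  apply: I_sum => i _; rewrite -[(_ ^ _).-1]prednK; last first.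
    rewrite -subn1 subn_gt0 -(exp1n i.+1) ltn_exp2r //; exact: finNzRing_gt1.
  rewrite exprSr mulrA; apply: IM => //; apply: integral_mul;
    first exact: integral_id.
  exact/integral_expr/integral_torsion.
elim: (m) => [|k IHk].
  by rewrite expr0 dvdp1; case/andP: Q_irr => _ /irreducibleP[sQ _];
    rewrite gtn_eqF.
by rewrite exprS monic_irreducible_dvdpM //
  (monic_irreducible_dvdp Q_irr P_irr) (negPf QP).
Qed.

(** Modulo I both sides are x^(q^(deg Q)), so their difference is a torsion point lying in I, hence
    0 by [torsion_I]. *)
Lemma frobenius_carlitz_act x : carlitz_torsion x -> s x = act Q x.
Proof.
move=> tx; have xi := integral_torsion tx.
have /andP[Qm /irreducibleP[sQ _]] := Q_irr.
have Q0 : Q != 0 by exact: monic_neq0.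
apply/eqP; rewrite -subr_eq0; apply/eqP/torsion_I.
  by rewrite /carlitz_torsion carlitz_actBr s_torsion //
    carlitz_torsion_act // subrr.
rewrite -(subrKA (x ^+ (q ^ (size Q).-1))); apply: ID; first exact: s_frob.
rewrite carlitz_actE -(big_mkord xpredT (fun i =>
  f (carlitz_coef Q i) * x ^+ (q ^ i))).
rewrite -{2}(prednK (_ : 0 < size Q)%N) ?size_poly_gt0 //.
rewrite big_nat_recr //= carlitz_coef_lead // (monicP Qm) polyC1 rmorph1 mul1r.
rewrite opprD addrCA subrr addr0 -mulN1r.
apply: IM; first by rewrite -(rmorphN1 f); exact: integral_id.
apply: I_sum => i; rewrite mem_index_iota => /= iQ.
rewrite mulrC; apply: IM; first exact: integral_expr.
exact/I_over/dvdp_carlitz_coef.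
Qed.

End Frobenius.
End CarlitzTorsion.

(** * The Galois group of a torsion field *)

Section CarlitzGalois.
Variables (F : finFieldType) (L : splittingFieldType {fraction {poly F}}).
Local Notation A := {poly F}.
Local Notation q := #|F|.

Fact of_A_is_zmod_morphism : zmod_morphism (@of_A F L).
Proof. by move=> a b; rewrite /of_A rmorphB scalerBl. Qed.

Fact of_A_is_monoid_morphism : monoid_morphism (@of_A F L).
Proof.
by split=> [|a b]; rewrite /of_A ?rmorph1 ?scale1r //
  rmorphM -scalerAl mul1r scalerA.
Qed.

HB.instance Definition _ := GRing.isZmodMorphism.Build {poly F} L (@of_A F L)
  of_A_is_zmod_morphism.
HB.instance Definition _ := GRing.isMonoidMorphism.Build {poly F} L (@of_A F L)
  of_A_is_monoid_morphism.

Local Notation ofA := (@of_A F L : {rmorphism {poly F} -> L}).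

Lemma of_A_inj : injective (@of_A F L).
Proof.
move=> a b /eqP; rewrite -subr_eq0 -rmorphB scaler_eq0 oner_eq0 orbF tofrac_eq0.
by rewrite subr_eq0 => /eqP.
Qed.

Lemma carlitz_inE (a : A) : carlitz_in L a = carlitz_poly ofA a.
Proof.
pose g (r : {poly L}) := ofA 'X *: r + r ^+ q.
rewrite (@carlitz_polyE F L ofA a g) // /carlitz_in /carlitz rmorph_sum.
apply: eq_bigr => l _; rewrite -[LHS]/(map_poly (in_alg L) _) map_polyZ;
  congr (_ *: _).
elim: (l : nat) => [|k IHk]; first by rewrite map_polyX.
by rewrite !iterS -IHk /phi_theta /g rmorphD rmorphXn /= map_polyZ.
Qed.

Lemma torsionE (a : A) x : torsion a x <-> carlitz_act ofA a x = 0.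
Proof.
by rewrite /torsion carlitz_inE rootE horner_carlitz_poly; split=> /eqP.
Qed.

Lemma gal_of_A (g : gal_of {:L}) (a : A) : g (of_A L a) = of_A L a.
Proof. by rewrite linearZ rmorph1. Qed.

Lemma gal_carlitz_act (g : gal_of {:L}) (a : A) x :
  g (carlitz_act ofA a x) = carlitz_act ofA a (g x).
Proof.
rewrite !carlitz_actE rmorph_sum; apply: eq_bigr => i _.
by rewrite rmorphM rmorphXn /= gal_of_A.
Qed.

Lemma galM_full (g h : gal_of {:L}) x : (g * h)%g x = h (g x).
Proof. by rewrite galM // memvf. Qed.

Lemma eq_gal_adjoin (rs : seq L) (g h : gal_of {:L}) :
  <<1 & rs>>%VS = {:L}%VS -> {in rs, g =1 h} -> g = h.
Proof.
move=> gen gh; apply: (mulIg h^-1%g); rewrite mulgV; apply/eqP/gal_eqP => x xL.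
rewrite gal_id; apply/fixedSpaceP; move: x xL; apply/subvP.
rewrite -[X in (X <= _)%VS]gen; apply/Fadjoin_seqP; split; first exact: sub1v.
move=> x xr; apply/fixedSpaceP.
by rewrite galM_full gh // -galM_full mulgV gal_id.
Qed.

Variables (P : A) (d m : nat).
Hypotheses (P_irr : monic_irreducible P) (P_deg : size P = d.+1) (m_gt0 : (0 <
  m)%N).
Hypothesis L_split : splittingFieldFor 1 (carlitz_in L (P ^+ m)) {:L}.
Variable Fr : A -> gal_of {:L}.
Hypothesis Fr_frob : forall Q, Q \is monic -> irreducible_poly Q -> Q != P ->
  is_frobenius Q (Fr Q).

Let acts (g : gal_of {:L}) (a : A) :=
  forall x, torsion (P ^+ m) x -> g x = carlitz_act ofA a x.

Let Fr_acts Q : monic_irreducible Q -> Q != P -> acts (Fr Q) Q.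
Proof.
move=> Qi QP x /torsionE tx; have /andP[Qm /irreducibleP Qirr] := Qi.
(* [is_frobenius] quantifies over the primes above Q, so it yields information only once such a
   prime is exhibited. *)
have [I [[I1 I2 I3 I4] [I5 I6 I7]]] := exists_prime_over of_A_inj Qi.
(* unqualified, [prime_above] is a lemma of prime.v *)
have IQ : Defs.prime_above Q I by split.
apply: (frobenius_carlitz_act of_A_inj P_irr Qi QP I2 I3 I4 I7 _ _ tx).
  move=> y ty; rewrite /carlitz_torsion -gal_carlitz_act.
  by move: ty; rewrite /carlitz_torsion => ->; rewrite rmorph0.
by move=> y; apply: Fr_frob IQ y.
Qed.

(** [rep g] is any a with g(l) = Phi_a(l) for a torsion generator l, so it matters only modulo P^m.
    Surjectivity comes from products of Frobenius elements. The clause on P-torsion serves both the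
    Teichmuller character and the subgroup Gamma. *)
Theorem carlitz_galois_rep : exists rep : gal_of {:L} -> A,
  [/\ forall g, ~~ (P %| rep g),
      forall g h, P ^+ m %| rep (g * h)%g - rep g * rep h,
      forall g h, P ^+ m %| rep g - rep h -> g = h &
      forall a, ~~ (P %| a) -> exists g, P ^+ m %| a - rep g] /\
  [/\ forall (g : gal_of {:L}) a, (forall x, torsion P x -> g x = (carlitz_in L
    a).[x]) <->
        P %| a - rep g &
      forall Q, monic_irreducible Q -> Q != P -> P ^+ m %| Q - rep (Fr Q)].
Proof.
have [rs split gen] := L_split; rewrite carlitz_inE in split.
have [l [tl lP]] := exists_torsion_generator of_A_inj P_irr P_deg m_gt0 split.
have rsP := mem_torsion split;
  have lgen := torsion_generated of_A_inj P_irr P_deg split lP.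
have gt (g : gal_of {:L}) x : carlitz_torsion ofA P m x -> carlitz_torsion ofA
  P m (g x).
  by rewrite /carlitz_torsion -gal_carlitz_act => ->; rewrite rmorph0.
have /choice[rep repP] : forall g : gal_of {:L}, exists a, g l = carlitz_act
  ofA a l.
  by move=> g; exact/lgen/gt.
have repA g : acts g (rep g).
  move=> x /torsionE /lgen[b ->].
  by rewrite gal_carlitz_act repP carlitz_act_comm.
have dvd_act a b : carlitz_act ofA a l = carlitz_act ofA b l -> P ^+ m %| a - b.
  by move=> ab; apply/lP; rewrite carlitz_actDl carlitz_actNl ab subrr.
have actsP g a : acts g a -> P ^+ m %| a - rep g.
  by move=> ga; apply: dvd_act; rewrite -repP ga //; apply/torsionE.
have actsE g a : P ^+ m %| a - rep g -> acts g a.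
  move=> ag x tx; rewrite repA // -[in RHS](subrK (rep g) a) carlitz_actDl.
  by rewrite (dvdp_carlitz_act (P := P) (m := m) (a := a - rep g)) ?add0r //;
    exact: (proj1 (torsionE _ _) tx).
have eq_acts g h a : acts g a -> acts h a -> g = h.
  move=> ga ha; apply: eq_gal_adjoin gen _ => x /rsP tx.
  by rewrite ga ?ha //; apply/torsionE.
have actsM g h a b : acts g a -> acts h b -> acts (g * h)%g (a * b).
  move=> ga hb x tx; rewrite galM_full ga // gal_carlitz_act hb //.
  by rewrite carlitz_actM.
have Pexp : P ^+ m = P ^+ m.-1 * P by rewrite -exprSr prednK.
have dP a : P ^+ m %| a -> P %| a by apply: dvdp_trans; rewrite Pexp dvdp_mull.
(* If P divided [rep g], then g, which is injective, would send the nonzero point Phi_(P^(m-1))(l)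
   to 0. *)
have repNP g : ~~ (P %| rep g).
  apply/negP => /dvdpP[b rb].
  have : carlitz_act ofA (P ^+ m.-1) l = 0.
    have : g (carlitz_act ofA (P ^+ m.-1) l) = 0.
      rewrite gal_carlitz_act repP rb -carlitz_actM.
      by rewrite mulrCA -Pexp carlitz_actM tl carlitz_act_r0.
    by move/eqP; rewrite fmorph_eq0 => /eqP.
  move/lP => /dvdp_leq; rewrite expf_neq0 ?monic_neq0 //;
    last by case/andP: P_irr.
  move=> /(_ isT); rewrite leqNgt => /negP; apply.
  have s0 k : (0 < size (P ^+ k))%N by rewrite size_poly_gt0 expf_neq0 //
    monic_neq0 //; case/andP: P_irr.
  rewrite -(prednK (s0 m)) -(prednK (s0 m.-1)) ltnS !size_exp P_deg /=.
  rewrite -{2}(prednK m_gt0) ltn_pmul2l //.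
  by case/andP: P_irr => _ /irreducibleP[]; rewrite P_deg.
exists rep; split; split=> //.
- move=> g h; rewrite -opprB dvdpNr; apply: actsP.
  by apply: actsM; exact: repA.
- by move=> g h gh; apply: (eq_acts _ _ (rep g)) => //; exact: actsE.
- have monic_acts a : a \is monic -> ~~ (P %| a) -> exists g, acts g a.
    have [n] := ubnP (size a); elim: n a => // n IHn a /ltnSE-sa am Pa.
    have [a1 | a1] := leqP (size a) 1.
      exists 1%g => x _; rewrite gal_id.
      move: am; rewrite [a]size1_polyC // monicE lead_coefC => /eqP->.
      by rewrite polyC1 carlitz_act1.
    have [Q Qi Qa] := exists_monic_irreducible_dvdp a1.
    have QP : Q != P by apply: contraNneq Pa => <-.
    have /andP[Qm /irreducibleP[sQ _]] := Qi.
    have ab : a = Q * (a %/ Q) by rewrite mulrC divpK.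
    have bm : a %/ Q \is monic by rewrite -(monicMl _ Qm) -ab.
    have [||g gb] := IHn (a %/ Q) _ bm.
    - rewrite (leq_trans _ sa) // size_divp ?monic_neq0 // ltn_subrL.
      by rewrite (ltnW a1) andbT -subn1 subn_gt0.
    - by apply: contra Pa; rewrite {2}ab; exact: dvdp_mull.
    exists (Fr Q * g)%g; rewrite ab; apply: actsM => //; exact: Fr_acts.
  (* Adding this multiple of P^m replaces a by a monic polynomial in the same class. *)
  move=> a Pa; pose b := P ^+ m * 'X^(size a).
  have Pm0 : P ^+ m \is monic by rewrite monic_exp //; case/andP: P_irr.
  have sb : (size a < size b)%N.
    rewrite /b size_Mmonic ?monicXn // ?monic_neq0 // size_polyXn addnS /=.
    by rewrite -[X in (X < _)%N]add0n ltn_add2r size_poly_gt0 monic_neq0.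
  have bP : P ^+ m %| b by rewrite /b dvdp_mulr.
  have [||g gab] := monic_acts (b + a).
  - by rewrite monicE lead_coefDl // lead_coefM (monicP Pm0) lead_coefXn mul1r.
  - by rewrite dvdp_addr // dP.
  exists g; have := actsP _ _ gab; by rewrite -addrA (dvdp_addr _ bP).
- move=> g a; split=> [ga | ga x /torsionE tx].
    apply/dvdpP.
    (* Phi_(P^(m-1))(l) is a P-torsion point whose annihilator is generated by P, so evaluating g
       there determines [rep g] modulo P. *)
    have : carlitz_act ofA (a - rep g) (carlitz_act ofA (P ^+ m.-1) l) = 0.
      rewrite carlitz_actDl carlitz_actNl -(horner_carlitz_poly ofA a)
        -carlitz_inE.
      have tPl : torsion P (carlitz_act ofA (P ^+ m.-1) l).
        by apply/torsionE; rewrite -carlitz_actM mulrC -Pexp tl.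
      rewrite -ga // repA ?subrr //; apply/torsionE.
      exact: carlitz_torsion_act.
    rewrite -carlitz_actM => /lP; rewrite Pexp [P ^+ _ * P]mulrC dvdp_mul2r;
      first by move/dvdpP.
    by rewrite expf_neq0 // monic_neq0 //; case/andP: P_irr.
  rewrite carlitz_inE horner_carlitz_poly repA; last first.
    by apply/torsionE; rewrite Pexp carlitz_actM tx carlitz_act_r0.
  rewrite -[in RHS](subrK (rep g) a) carlitz_actDl.
  by have /dvdpP[b ->] := ga; rewrite carlitz_actM tx carlitz_act_r0 add0r.
- by move=> Q Qi QP; apply: actsP; exact: Fr_acts.
Qed.

End CarlitzGalois.

(** * Components of the Stickelberger series *)

Section GroupRingElements.
Variables (R : nzRingType) (gT : finGroupType).

Lemma gr_coef_elt (g h : gT) : gr_coef (gr_elt R g) h = (h == g)%:R.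
Proof. by rewrite /gr_coef ffunE. Qed.

Lemma gr_eltM (g h : gT) : gr_elt R (g * h)%g = gr_elt R g * gr_elt R h.
Proof.
apply/ffunP => x; rewrite !ffunE (bigD1 g) //= !gr_coef_elt eqxx mul1r big1
  ?addr0.
  by rewrite (can2_eq (mulKVg g) (mulKg g)).
by move=> y /negPf yg; rewrite gr_coef_elt yg mul0r.
Qed.

Lemma gr_eltX (g : gT) k : gr_elt R (g ^+ k)%g = gr_elt R g ^+ k.
Proof. by elim: k => // k IHk; rewrite expgS exprS gr_eltM IHk. Qed.

Lemma gr_coef_sum (I : Type) (r : seq I) (C : pred I) (G : I -> group_ring R
  gT) h :
  gr_coef (\sum_(x <- r | C x) G x) h = \sum_(x <- r | C x) gr_coef (G x) h.
Proof.
by elim/big_rec2: _ => [|x u v _ <-]; rewrite /gr_coef ffunE.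
Qed.

Lemma gr_coef_natl k (x : group_ring R gT) h :
  gr_coef (k%:R * x) h = k%:R * gr_coef x h.
Proof. by rewrite !mulr_natl /gr_coef ffunMnE. Qed.

End GroupRingElements.

(* rep : gT -> {poly F} plays the role of an isomorphism from gT onto
   (A / P ^+ m)^*, given by representatives; sg is its inverse. *)
Section RayClassGroup.
Variables (F : finFieldType) (p : nat) (P : {poly F}) (d m : nat).
Hypotheses (char_p : p \in [pchar F]) (P_irr : monic_irreducible P)
  (P_deg : size P = d.+1) (m_gt0 : (0 < m)%N).
Variables (gT : finGroupType) (G Gam : {group gT}) (rep : gT -> {poly F}).
Hypothesis G_full : forall g, g \in G.
Hypothesis repP : forall g, ~~ (P %| rep g).
Hypothesis repM : forall g h, P ^+ m %| rep (g * h)%g - rep g * rep h.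
Hypothesis rep_inj : forall g h, P ^+ m %| rep g - rep h -> g = h.
Hypothesis mem_Gam : forall g, (g \in Gam) = (P %| rep g - 1).
Local Notation q := #|F|.
Local Notation Delta := 'O_p^'(G)%G.
Implicit Types (a b c : {poly F}) (g h s : gT).

Let p_pr : prime p := pcharf_prime char_p.
Let Pm : P \is monic. Proof. by case/andP: P_irr. Qed.
Let P0 k : P ^+ k != 0. Proof. by rewrite expf_neq0 // monic_neq0. Qed.
Let P_poly : irreducible_poly P. Proof. by case/andP: P_irr =>
  _ /irreducibleP. Qed.
Let sizeP k : size (P ^+ k) = (d * k).+1.
Proof. by rewrite -[LHS]prednK ?size_poly_gt0 // size_exp P_deg. Qed.
Let dvdpPm a : P ^+ m %| a -> P %| a.
Proof. by apply: dvdp_trans; rewrite -(prednK m_gt0) exprS dvdp_mulr. Qed.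
Let coprimePm a : ~~ (P %| a) -> coprimep (P ^+ m) a.
Proof. by move=> Pa; rewrite coprimep_expl // irreducible_poly_coprime. Qed.
Let dvdpPM a b : (P %| a * b) = (P %| a) || (P %| b).
Proof. exact: monic_irreducible_dvdpM. Qed.

Lemma exprD_p (R : comNzRingType) (f : {rmorphism F -> R}) k (x y : R) :
  (x + y) ^+ (p ^ k) = x ^+ (p ^ k) + y ^+ (p ^ k).
Proof.
apply: exprDn_pchar; rewrite pnatX (eq_pnat p (pcharf_eq (rmorph_pchar f
  char_p))).
by rewrite pnat_id.
Qed.

Let expr_sub1 a k : (a - 1) ^+ (p ^ k) = a ^+ (p ^ k) - 1.
Proof.
apply: (addIr 1); rewrite subrK -[X in _ + X](expr1n _ (p ^ k)).
by rewrite -(@exprD_p _ polyC) subrK.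
Qed.

Lemma rep1 : P ^+ m %| rep 1%g - 1.
Proof.
have := repM 1%g 1%g; rewrite mulg1 -{1}[rep 1%g]mulr1 -mulrBr Gauss_dvdpr.
  by rewrite -opprB dvdpNr.
exact/coprimePm.
Qed.

Lemma repX g k : P ^+ m %| rep (g ^+ k)%g - rep g ^+ k.
Proof.
elim: k => [|k IHk]; first by rewrite expg0 expr0 rep1.
rewrite expgS exprS -(subrKA (rep g * rep (g ^+ k)%g)) dvdp_add ?repM //.
by rewrite -mulrBr dvdp_mull.
Qed.

Lemma ray_abelian : abelian G.
Proof.
apply/centsP => g _ h _; apply: rep_inj.
rewrite -(subrKA (rep g * rep h)) dvdp_add ?repM //.
by rewrite mulrC -opprB dvdpNr repM.
Qed.

Lemma ray_commute g h : commute g h.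
Proof. exact: (centsP ray_abelian). Qed.

(** Since (r - 1)^(p^k) = r^(p^k) - 1, a class of p-power order is 1 modulo P; conversely, if P
    divides r - 1, then P^m divides r^(p^m) - 1 because m <= p^m. *)
Lemma p_elt_Gam g : (p.-elt g)%g = (g \in Gam).
Proof.
apply/idP/idP => [/p_natP[k gk] | ].
  rewrite mem_Gam; have := rep1; rewrite -(expg_order g) gk => /dvdpPm H.
  suff : P %| (rep g - 1) ^+ (p ^ k).
    elim: (p ^ k)%N => [|n IHn]; last by rewrite exprS dvdpPM => /orP[].
    by rewrite expr0 dvdp1 gtn_eqF //; case: P_poly.
  rewrite expr_sub1 -(subrKA (rep (g ^+ (p ^ k))%g)) addrC dvdp_add //.
  by rewrite -opprB dvdpNr; apply/dvdpPm/repX.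
rewrite mem_Gam => Pg.
have : (g ^+ (p ^ m) = 1)%g.
  apply: rep_inj; rewrite -(subrKA 1) dvdp_add //;
    last by rewrite -opprB dvdpNr rep1.
  rewrite -(subrKA (rep g ^+ (p ^ m))) dvdp_add ?repX // -expr_sub1.
  apply: dvdp_trans (dvdp_exp2r (p ^ m) Pg); rewrite dvdp_exp2l //.
  by rewrite ltnW // ltn_expl // prime_gt1.
move/eqP; rewrite -order_dvdn => gm; rewrite /p_elt.
by apply: pnat_dvd gm _; rewrite pnatX pnat_id.
Qed.

Lemma p'_elt_Delta g : (p^'.-elt g)%g = (g \in Delta).
Proof.
apply/idP/idP => [g' | ]; last exact/mem_p_elt/pcore_pgroup.
rewrite -cycle_subG pcore_max //.
by rewrite -sub_abelian_normal ?ray_abelian // cycle_subG.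
Qed.

Lemma ray_decomposition g s : s \in Gam ->
  (g.`_p = s)%g <-> (exists2 h, h \in Delta & g = h * s)%g.
Proof.
move=> sG; split=> [<- | [h hD ->]].
  exists (g.`_p^')%g; first by rewrite -p'_elt_Delta p_elt_constt.
  by rewrite -{1}[g](consttC p) ray_commute.
rewrite consttM; last exact: ray_commute.
by rewrite (constt1P _) ?p'_elt_Delta // constt_p_elt ?mul1g ?p_elt_Gam.
Qed.

Lemma rep_p'part g : P %| rep (g.`_p^')%g - rep g.
Proof.
have H : P %| rep g - rep (g.`_p)%g * rep (g.`_p^')%g.
  by apply/dvdpPm; rewrite -{1}[g](consttC p) repM.
have : (g.`_p)%g \in Gam by rewrite -p_elt_Gam p_elt_constt.
rewrite mem_Gam => H1.
rewrite -opprB dvdpNr -(subrKA (rep (g.`_p)%g * rep (g.`_p^')%g)) dvdp_add //.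
by rewrite -{2}[rep (g.`_p^')%g]mul1r -mulrBl dvdp_mulr.
Qed.

Variable sg : {poly F} -> gT.
Hypothesis sgP : forall a, ~~ (P %| a) -> P ^+ m %| a - rep (sg a).

Lemma sg_eq a g : ~~ (P %| a) -> P ^+ m %| a - rep g -> sg a = g.
Proof.
move=> Pa ag; apply: rep_inj; rewrite -(subrKA a) dvdp_add //.
by rewrite -opprB dvdpNr sgP.
Qed.

Lemma sgM a b : ~~ (P %| a) -> ~~ (P %| b) -> sg (a * b) = (sg a * sg b)%g.
Proof.
move=> Pa Pb; apply: sg_eq; first by rewrite dvdpPM negb_or Pa.
rewrite -(subrKA (rep (sg a) * rep (sg b))) dvdp_add //; last first.
  by rewrite -opprB dvdpNr repM.
rewrite -(subrKA (a * rep (sg b))) -mulrBr -mulrBl.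
by apply: dvdp_add; [apply/dvdp_mull/sgP | apply/dvdp_mulr/sgP].
Qed.

Lemma sg1 : sg 1 = 1%g.
Proof.
apply: sg_eq; last by rewrite -opprB dvdpNr rep1.
by rewrite dvdp1 gtn_eqF //; case: P_poly.
Qed.

Lemma sgX a k : ~~ (P %| a) -> sg (a ^+ k) = (sg a ^+ k)%g.
Proof.
move=> Pa; elim: k => [|k IHk]; first by rewrite sg1.
rewrite exprS expgS sgM ?IHk //.
elim: k {IHk} => [|k IHk]; last by rewrite exprS dvdpPM negb_or Pa.
by rewrite dvdp1 gtn_eqF //; case: P_poly.
Qed.

(** * The Teichmuller character and the sums twisted by its powers *)

Section WittCharacter.
Variables (W : comNzRingType) (red : {rmorphism W -> {poly %/ P}}).
Hypothesis W_witt : is_witt_ring p red.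
Variable omega : gT -> W.
Local Notation n := (q ^ d - 1)%N.
Hypothesis omegaP : forall h, h \in Delta ->
  omega h ^+ n = 1 /\ red (omega h) = in_qpoly P (rep h).

Let rho : {rmorphism {poly F} -> {poly %/ P}} := in_qpoly P.

Let rho_eq0 a : rho a = 0 <-> P %| a.
Proof. exact: in_qpoly_eq0. Qed.

Let rho_eq a b : P %| a - b -> rho a = rho b.
Proof. by move/rho_eq0; rewrite rmorphB => /eqP; rewrite subr_eq0 => /eqP. Qed.

Let rho_val (x : {poly %/ P}) : rho (val x) = x.
Proof. apply/val_inj/in_qpoly_small; exact: size_mk_monic. Qed.

Let qpoly_mulf_eq0 (x y : {poly %/ P}) : x * y = 0 -> x = 0 \/ y = 0.
Proof.
rewrite -(rho_val x) -(rho_val y) -rmorphM => /rho_eq0; rewrite dvdpPM.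
by case/orP => /rho_eq0; [left | right].
Qed.

(** Descent on p: u x = 0 forces red x = 0, so x = p z with u z = 0 again. Hence x lies in every p^k
    W. *)
Lemma witt_regular (u x : W) : red u <> 0 -> u * x = 0 -> x = 0.
Proof.
move=> u0 ux; apply: (witt_separated W_witt) => k.
suff [y [-> _]] : exists y, x = p%:R ^+ k * y /\ u * y = 0 by exists y.
elim: k => [|k [y [-> uy]]]; first by exists x; rewrite expr0 mul1r.
have [z yz] : exists z, y = p%:R * z.
  apply/(witt_red_ker W_witt); have := congr1 red uy; rewrite rmorphM rmorph0.
  by case/qpoly_mulf_eq0.
exists z; split; first by rewrite yz exprSr mulrA.
by apply: (witt_torsion_free W_witt); rewrite mulrCA -yz.
Qed.

Let q_eq0 : q%:R = 0 :> {poly %/ P}.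
Proof. by rewrite -(rmorph_nat (rho \o polyC)) natr_card_finField rmorph0. Qed.

Let d_gt0 : (0 < d)%N. Proof. by case: P_poly; rewrite P_deg. Qed.

Let n_gt0 : (0 < n)%N.
Proof. by rewrite subn_gt0 -(exp1n d) ltn_exp2r // finNzRing_gt1. Qed.

Let natr_n : n%:R = -1 :> {poly %/ P}.
Proof.
rewrite natrB; last by rewrite expn_gt0 ltnW // finNzRing_gt1.
by rewrite natrX q_eq0 expr0n gtn_eqF // sub0r.
Qed.

(** The cofactor of x - y in x^n - y^n reduces to n y^(n-1) = - y^(n-1), which is nonzero, so it is
    regular. This makes [omega], specified value by value, a homomorphism. *)
Lemma root_of_unity_inj (x y : W) : x ^+ n = 1 -> y ^+ n = 1 ->
  red x = red y -> x = y.
Proof.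
move=> x1 y1 xy; apply/eqP; rewrite -subr_eq0; apply/eqP.
apply: (@witt_regular (\sum_(k < n) x ^+ (n.-1 - k) * y ^+ k)); last first.
  by rewrite mulrC -subrXX x1 y1 subrr.
have yn : red y ^+ n = 1 by rewrite -rmorphXn y1 rmorph1.
rewrite rmorph_sum (eq_bigr (fun=> red y ^+ n.-1)) => [|k _].
  rewrite sumr_const card_ord -mulr_natr natr_n => E.
  have := congr1 (fun z => red y * z) E;
    rewrite mulr0 mulrA -exprS prednK // yn.
  by rewrite mul1r => /eqP; rewrite oppr_eq0 oner_eq0.
rewrite rmorphM !rmorphXn xy -exprD subnK //.
by have := ltn_ord k; rewrite -{2}(prednK n_gt0).
Qed.

Lemma omegaM g h : g \in Delta -> h \in Delta -> omega (g * h)%g = omega g *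
  omega h.
Proof.
move=> gD hD; have [g1 gr] := omegaP gD; have [h1 hr] := omegaP hD.
have [gh1 ghr] := omegaP (groupM gD hD); apply: root_of_unity_inj => //.
  by rewrite exprMn g1 h1 mulr1.
rewrite rmorphM ghr gr hr; apply: etrans (rmorphM rho _ _).
by apply: rho_eq; apply: dvdpPm; exact: repM.
Qed.

Lemma omega1 : omega 1%g = 1.
Proof.
have [x1 xr] := omegaP (group1 Delta); apply: root_of_unity_inj => //.
  by rewrite expr1n.
rewrite xr rmorph1; apply: etrans (rmorph1 rho).
exact/rho_eq/dvdpPm/rep1.
Qed.

Lemma omegaX g k : g \in Delta -> omega (g ^+ k)%g = omega g ^+ k.
Proof.
move=> gD; elim: k => [|k IHk]; first by rewrite expg0 omega1.
by rewrite expgS exprS omegaM ?groupX // IHk.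
Qed.

(** The residue of g^n is the reduction of omega(g)^n = 1, so g^n lies in both Gam and Delta. *)
Lemma Delta_expg g : g \in Delta -> (g ^+ n = 1)%g.
Proof.
move=> gD; have [g1 gr] := omegaP gD; apply/eqP; rewrite -order_eq1.
suff gG : (g ^+ n)%g \in Gam.
  move: gG; rewrite -p_elt_Gam => gp; have := groupX n gD;
    rewrite -p'_elt_Delta => gp'.
  by apply/eqP; apply: (@pnat_1 p).
rewrite mem_Gam -(subrKA (rep g ^+ n)) dvdp_add //; first exact/dvdpPm/repX.
apply/rho_eq0; rewrite rmorphB rmorphXn rmorph1.
by have := congr1 red g1; rewrite rmorphXn gr rmorph1 => ->; rewrite subrr.
Qed.

Variable i : nat.
Hypotheses (i_gt0 : (0 < i)%N) (i_lt : (i < n)%N).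

(* The contribution of a to the coefficient at s of Theta_n(X, omega^i). *)
Definition twist s a : W :=
  if ~~ (P %| a) && ((sg a)^-1.`_p == s)%g then omega (sg a)^-1.`_p^'%g ^+ i
    else 0.

Lemma exists_Delta_nontrivial :
  exists2 h, h \in Delta & red (omega h ^+ i - 1) <> 0.
Proof.
have hI : monic_irreducible_poly P by [].
have cE : #|{poly %/ P with hI}|.-1 = n by rewrite card_qfpoly P_deg subn1.
have [|x x0 xi] := @finField_expf_neq1 {poly %/ P with hI} i.
  by rewrite cE gtnNdvd.
have Px : ~~ (P %| val x).
  by apply/negP => /rho_eq0; rewrite rho_val => x00; move/eqP: x0.
pose h := ((sg (val x)).`_p^')%g.
have hD : h \in Delta by rewrite -p'_elt_Delta p_elt_constt.
exists h => //; have [_ hr] := omegaP hD.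
rewrite rmorphB rmorphXn rmorph1 hr => /eqP; rewrite subr_eq0.
have -> : in_qpoly P (rep h) = x :> {poly %/ P}.
  rewrite -[RHS]rho_val; apply: rho_eq; rewrite -(subrKA (rep (sg (val x)))).
  by rewrite dvdp_add ?rep_p'part // -opprB dvdpNr; apply/dvdpPm/sgP.
by move=> xi1; move/negP: xi.
Qed.

Lemma twist_mul s a b h : h \in Delta -> ~~ (P %| a) -> ~~ (P %| b) ->
  sg b = (h^-1 * sg a)%g -> twist s b = twist s a * omega h ^+ i.
Proof.
move=> hD Pa Pb E; rewrite /twist Pa Pb /= E invMg invgK.
have h' : (p^'.-elt h)%g by rewrite p'_elt_Delta.
have hp : (h.`_p = 1)%g by apply/constt1P.
rewrite !consttM; try exact: ray_commute.
rewrite hp mulg1 (constt_p_elt h'); case: ifP => _; last by rewrite mul0r.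
by rewrite omegaM ?exprMn // -p'_elt_Delta p_elt_constt.
Qed.

(* Multiplication by the class of h^-1 permutes the summands and multiplies the
   sum by omega h ^+ i, and omega h ^+ i - 1 is regular. *)
Lemma sum_twist_eq0 s N (C : pred {poly F}) : (d * m <= N)%N ->
  (forall a r : {poly F}, (size r <= d * m)%N -> C (a + r) = C a) ->
  \sum_(a : {poly_N F} | C a) twist s a = 0.
Proof.
move=> dN CS; have [h hD h1] := exists_Delta_nontrivial.
apply: (witt_regular h1); rewrite mulrBl mul1r; apply/eqP; rewrite subr_eq0;
  apply/eqP.
(* The permutation a -> a + r a keeps the quotient by P^m and replaces the remainder by that of c a.
   It moves a within the class demanded while changing it too little to affect C. *)
pose c := rep (h^-1)%g; pose r a := (c * a) %% (P ^+ m) - a %% (P ^+ m).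
have sr a : (size (r a) <= d * m)%N.
  have sm (x : {poly F}) : (size (x %% P ^+ m)%R <= d * m)%N.
    by rewrite -ltnS -sizeP ltn_modp P0.
  by rewrite (leq_trans (size_polyD _ _)) // size_polyN geq_max !sm.
have sT (a : {poly_N F}) : (size ((a : {poly F}) + r a)%R <= N)%N.
  by rewrite (leq_trans (size_polyD _ _)) //
    geq_max size_npoly (leq_trans (sr _)).
have TE a : a + r a = a %/ P ^+ m * P ^+ m + (c * a) %% P ^+ m.
  by rewrite {1}(divp_eq a (P ^+ m)) /r addrACA subrr addr0.
pose T (a : {poly_N F}) : {poly_N F} := npolyp N ((a : {poly F}) + r a).
have TV (a : {poly_N F}) : T a = (a : {poly F}) + r a :> {poly F} by rewrite
  npolypK.
have Tinj : injective T.
  move=> a b ab; apply/val_inj; have := congr1 val ab; rewrite /= !TV !TE => E.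
  have smod x : (size ((c * x) %% P ^+ m)%R < size (P ^+ m)%R)%N by rewrite
    ltn_modp P0.
  rewrite (divp_eq a (P ^+ m)) (divp_eq b (P ^+ m)); congr (_ * _ + _).
    have := congr1 (fun x => x %/ P ^+ m) E.
    by rewrite !divp_addl_mul_small.
  have := congr1 (fun x => x %% P ^+ m) E;
    rewrite !modp_addl_mul_small // => /eqP.
  rewrite -subr_eq0 -modpN -modpD -mulrBr => /eqP/modp_eq0P.
  rewrite Gauss_dvdpr; last by apply: coprimePm; exact: repP.
  by move/modp_eq0P/eqP; rewrite modpD modpN subr_eq0 => /eqP.
rewrite [RHS](reindex_inj Tinj) mulr_sumr; apply: eq_big => [a | a _].
  by rewrite TV CS.
have TP : P ^+ m %| (T a : {poly F}) - c * a.
  rewrite TV TE {2}(divp_eq (c * a) (P ^+ m)) opprD addrACA subrr addr0 -mulrBl.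
  by rewrite dvdp_mull.
have PT : (P %| T a) = (P %| a).
  rewrite -[polyn (T a)](subrK (c * a)) (dvdp_addr _ (dvdpPm TP)) dvdpPM.
  by rewrite (negPf (repP _)).
have [Pa | Pa] := boolP (P %| a); first by rewrite /twist PT Pa mulr0.
rewrite mulrC; symmetry; apply: twist_mul => //; first by rewrite PT.
apply: sg_eq; first by rewrite PT.
rewrite -(subrKA (c * a)) dvdp_add // -(subrKA (c * rep (sg a))) dvdp_add //.
  by rewrite -mulrBr dvdp_mull // sgP.
by rewrite -opprB dvdpNr repM.
Qed.

(** By [chi_part_theta] below, this is the coefficient at s of the X^k-coefficient of Theta_n(X,
    omega^i). *)
Definition theta k s : W :=
  \sum_(b : {poly_k F}) twist s ('X^k + (b : {poly F})).

Lemma theta_eq0 k s : (d * m <= k)%N -> theta k s = 0.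
Proof.
move=> dk; rewrite /theta -(@big_npoly_monic _ _ k k.+1 (twist s)) //.
apply: sum_twist_eq0; first exact: leqW.
move=> a r sr; rewrite /monic_deg; have [sa | sa] := ltnP (size r) (size a).
  by rewrite size_polyDl // !monicE lead_coefDl.
apply/andP/andP => -[_ /eqP E].
  have := size_polyD a r; rewrite E (maxn_idPr sa) => /leq_trans/(_ sr).
  by move/leq_trans/(_ dk); rewrite ltnn.
by have := leq_trans sa (leq_trans sr dk); rewrite E ltnn.
Qed.

(** The class of c has order dividing q - 1, which is prime to p, so it lies in Delta; there omega^i
    is trivial on it because q - 1 divides i. *)
Lemma twistZ s (c : F) a : (q.-1 %| i)%N -> c != 0 -> twist s (c *: a) = twist
  s a.
Proof.
move=> qi c0; have [Pa | Pa] := boolP (P %| a).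
  by rewrite /twist dvdpZr // Pa.
have Pc : ~~ (P %| c%:P).
  by apply/negP => /dvdp_leq;
    rewrite polyC_eq0 c0 size_polyC c0 P_deg ltnS leqNgt d_gt0 => /(_ isT).
have sc : (sg c%:P ^+ q.-1 = 1)%g.
  by rewrite -sgX // -polyC_exp finField_expf_pred // sg1.
have cD : ((sg c%:P)^-1)%g \in Delta.
  rewrite groupV -p'_elt_Delta; move/eqP: sc; rewrite -order_dvdn /p_elt => H.
  apply: (pnat_dvd H); rewrite p'natE // -subn1 dvdn_subr //; last first.
  - rewrite (card_pprimeChar char_p) dvdn_exp //.
    by case: (logn _ _) (card_pprimeChar char_p) (finNzRing_gt1 F) => // ->.
  - exact: ltnW (finNzRing_gt1 F).
  by rewrite dvdn1 gtn_eqF // prime_gt1.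
rewrite (@twist_mul s a (c *: a) _ cD) ?dvdpZr //.
  have /dvdnP[j ->] := qi;
    rewrite mulnC exprM -omegaX // expgVn sc invg1 omega1.
  by rewrite expr1n mulr1.
by rewrite invgK -mul_polyC sgM.
Qed.

(* Up to the factor q - 1, this is the sum over all nonzero a of size at most
   N, since twist s is invariant under F^*. *)
Lemma sum_theta_eq0 N s : (d * m <= N)%N -> (q.-1 %| i)%N ->
  \sum_(k < N) theta k s = 0.
Proof.
move=> dN qi; have := @sum_twist_eq0 s N predT dN (fun _ _ _ => erefl).
rewrite (@sum_npoly_homogeneous _ _ _ (twist s)) => [|c a]; last exact: twistZ.
rewrite /twist dvdp0 add0r -mulr_natl; apply: witt_regular.
rewrite rmorph_nat -subn1 natrB ?q_eq0 ?sub0r;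
  last exact: ltnW (finNzRing_gt1 F).
by move/eqP; rewrite oppr_eq0 oner_eq0.
Qed.

Local Notation j := (n - i)%N.

(** The reduction of omega(sigma_a^-1)^i is a^(-i), and this equals a^(n - i) in the residue
    field. *)
Lemma red_twist s a : ~~ (P %| a) ->
  red (twist s a) = if ((sg a)^-1.`_p == s)%g then rho (a ^+ j) else 0.
Proof.
move=> Pa; rewrite /twist Pa /=; case: ifP => _; last exact: rmorph0.
set g := ((sg a)^-1)%g;
  have gD : (g.`_p^')%g \in Delta by rewrite -p'_elt_Delta p_elt_constt.
have [g1 gr'] := omegaP gD.
have gr : red (omega (g.`_p^')%g) = rho (rep (g.`_p^')%g) by exact: gr'.
rewrite rmorphXn gr.
have gE : rho (rep (g.`_p^')%g) = rho (rep g) by apply: rho_eq;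
  exact: rep_p'part.
have g1' : rho (rep g) ^+ n = 1 by rewrite -gE -gr -rmorphXn g1 rmorph1.
have ga : rho (rep g) * rho a = 1.
  rewrite -rmorphM -(rmorph1 rho); apply: rho_eq; apply: dvdpPm.
  rewrite -(subrKA (rep g * rep (sg a))) -mulrBr dvdp_add ?dvdp_mull ?sgP //.
  rewrite -(subrKA (rep (g * sg a)%g)) dvdp_add //;
    first by rewrite -opprB dvdpNr repM.
  by rewrite mulVg rep1.
rewrite gE rmorphXn -[LHS]mulr1 -(expr1n _ j) -ga exprMn mulrA -exprD subnKC
  ?g1' ?mul1r //.
exact: ltnW.
Qed.

Let Delta_expg_card h : h \in Delta -> (h ^+ (q ^ (d * m)) = h)%g.
Proof.
move=> hD; rewrite expnM; elim: (m) => [|k IHk]; first by rewrite expn0 expg1.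
rewrite expnSr expgM IHk -(subnK (_ : 1 <= q ^ d)%N) ?expn_gt0 ?(ltnW
  (finNzRing_gt1 F)) //.
by rewrite expgD Delta_expg // mul1g expg1.
Qed.

(* On the class of s, raising a to the power q ^ (d * m), which is trivial on
   Delta, amounts to multiplying a by a factor depending on s only. *)
Let class_congr a s : ~~ (P %| a) -> s \in Gam -> ((sg a)^-1.`_p)%g = s ->
  P ^+ m %| a ^+ (q ^ (d * m)) * rep s^-1%g - a * rep s^-1%g ^+ (q ^ (d * m)).
Proof.
move=> Pa sG as_; set M := (q ^ (d * m))%N; set r := rep _.
have Pr : ~~ (P %| r) by exact: repP.
have PX b k : ~~ (P %| b) -> ~~ (P %| b ^+ k).
  move=> Pb; elim: k => [|k IHk]; last by rewrite exprS dvdpPM negb_or Pb.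
  by rewrite dvdp1 gtn_eqF //; case: P_poly.
have sgr : sg r = (s^-1)%g by apply: sg_eq; rewrite // subrr dvdp0.
have E : sg (a ^+ M * r) = sg (a * r ^+ M).
  rewrite !sgM ?PX // !sgX // sgr.
  have [h hD gh] : exists2 h, h \in Delta & ((sg a)^-1 = h * s)%g.
    by apply/ray_decomposition.
  have -> : sg a = (h^-1 * s^-1)%g by rewrite -(invgK (sg a)) gh invMg
    ray_commute.
  rewrite expgMn; last exact: ray_commute.
  by rewrite (Delta_expg_card (groupVr hD)) -!mulgA; congr (_ * _)%g;
    exact: ray_commute.
rewrite -(subrKA (rep (sg (a ^+ M * r)))) dvdp_add ?sgP ?dvdpPM ?negb_or ?PX //.
by rewrite E -opprB dvdpNr sgP // dvdpPM negb_or Pa PX.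
Qed.

Lemma dvdp_sum_coprime (ks : seq nat) :
  (forall s, s \in Gam -> red (\sum_(k <- ks) theta k s) = 0) ->
  P ^+ m %| \sum_(k <- ks) monic_power_sum_coprime P k j.
Proof.
move=> H; pose cls s a := ~~ (P %| a) && ((sg a)^-1.`_p == s)%g.
pose X s : {poly F} := \sum_(k <- ks) \sum_(b : {poly_k F} | cls s ('X^k + (b :
  {poly F})))
  ('X^k + (b : {poly F})) ^+ j.
have XP s : s \in Gam -> P %| X s.
  move=> sG; apply/rho_eq0; rewrite -(H s sG) !rmorph_sum;
    apply: eq_bigr => k _.
  rewrite !rmorph_sum big_mkcond; apply: eq_bigr => b _; rewrite /cls.
  have [Pb | Pb] /= := boolP (P %| _); first by rewrite /twist Pb rmorph0.
  by rewrite red_twist.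
have XPm s : s \in Gam -> P ^+ m %| X s.
  move=> sG; set M := (q ^ (d * m))%N.
  have cr : coprimep (P ^+ m) (rep s^-1%g ^+ (M * j)).
    by rewrite coprimep_expr // coprimePm ?repP.
  (* With r = [rep s^-1], [class_congr] gives r^(M j) X = r^j X^M modulo P^m, term by term since
     raising to the power M is additive. As P divides X and m <= M, P^m divides X^M; and r is prime
     to P. *)
  rewrite -(Gauss_dvdpr _ cr) -(subrK (rep s^-1%g ^+ j * X s ^+ M) (_ * X s)).
  rewrite dvdp_add //; last first.
    rewrite dvdp_mull //; apply: dvdp_trans (dvdp_exp2r M (XP s sG)).
    rewrite dvdp_exp2l // (leq_trans (leq_pmull m d_gt0)) // ltnW //.
    by rewrite ltn_expl // finNzRing_gt1.
  rewrite /X !(@expr_sum_card _ _ polyC) !mulr_sumr -sumrB;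
    apply: (big_ind (fun x => P ^+ m %| x)).
  - exact: dvdp0.
  - by move=> u v; exact: dvdp_add.
  move=> k _; rewrite !(@expr_sum_card _ _ polyC) !mulr_sumr -sumrB;
    apply: (big_ind (fun x => P ^+ m %| x)).
  - exact: dvdp0.
  - by move=> u v; exact: dvdp_add.
  move=> b /andP[Pb /eqP bs]; set a := _ + _ in Pb bs *.
  rewrite [_ ^+ (M * j)]exprM [(a ^+ j) ^+ M]exprAC -!exprMn -opprB dvdpNr
    subrXX.
  rewrite ![rep _ * _]mulrC ![rep _ ^+ _ * _]mulrC dvdp_mulr //.
  exact: class_congr.
have -> : \sum_(k <- ks) monic_power_sum_coprime P k j = \sum_(s in Gam) X s.
  rewrite exchange_big /=; apply: eq_bigr => k _.
  rewrite (exchange_big_dep (fun b : {poly_k F} =>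
    ~~ (P %| 'X^k + (b : {poly F})))) /=; last first.
    by move=> s b _ /andP[].
  apply: eq_bigr => b Pb; set g := ((sg ('X^k + b))^-1)%g.
  have gG : (g.`_p)%g \in Gam by rewrite -p_elt_Gam p_elt_constt.
  rewrite (bigD1 (g.`_p)%g) /=; last by rewrite gG /cls Pb eqxx.
  rewrite big1 ?addr0 // => s /andP[/andP[_ /andP[_ /eqP <-]]].
  by rewrite eqxx.
by apply: (big_ind (fun x => P ^+ m %| x)) => [|u v|s /XPm //];
  [exact: dvdp0 | exact: dvdp_add].
Qed.

Section EulerFactors.
Variable fr : {poly F} -> gT.
Hypothesis frP : forall Q, monic_irreducible Q -> Q != P -> P ^+ m %| Q - rep
  (fr Q).

Lemma stickelberger_coef k :
  (\prod_(Q : {poly_k.+1 F} |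
           [&& (Q : {poly F}) \is monic, `[< irreducible_poly (Q : {poly F}) >]
             & (Q : {poly F}) != P])
     \sum_(l < k.+1)
       (gr_elt int ((fr Q)^-1 ^+ l)%g)%:P * 'X^(l * (size (Q : {poly
         F})).-1))`_k
  = \sum_(a : {poly_k.+1 F} | monic_deg k a && ~~ (P %| a)) gr_elt int (sg
    a)^-1%g.
Proof.
pose e a := gr_elt int (sg a)^-1%g.
pose cond (Q : {poly_k.+1 F}) := monic_irreducible Q && ((Q : {poly F}) != P).
pose s := [seq polyn Q | Q <- [seq Q <- index_enum _ | cond Q]].
have mem_s Q : (Q \in s) = [&& monic_irreducible Q, Q != P & (size Q <=
  k.+1)%N].
  apply/mapP/and3P => [[R RS ->] | [Qi QP sQ]].
    by move: RS; rewrite mem_filter => /andP[/andP[Ri RP] _];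
      rewrite size_npoly.
  exists (npolyp k.+1 Q); last by rewrite npolypK.
  by rewrite mem_filter mem_index_enum andbT /cond npolypK // Qi.
have e1 : e 1 = 1 by rewrite /e sg1 invg1.
have eM a b : a \is monic -> b \is monic -> ~~ (P %| a) -> ~~ (P %| b) ->
    e (a * b) = e a * e b.
  by move=> _ _ Pa Pb; rewrite /e sgM // invMg -gr_eltM ray_commute.
have us : uniq s.
  by rewrite map_inj_uniq ?filter_uniq ?index_enum_uniq //; exact: val_inj.
have := euler_product_coef e1 eM us (t := [:: P]) (k := k).
move=> /(_ _ _ _ _ _ k (leqnn k)) /= E.
transitivity (\sum_(a : {poly_k.+1 F} | monic_deg k a && (~~ (P %| a) && true))
  e a).
  rewrite -E => [||Q|||Q Qi sQ]; first last.
  - by rewrite mem_s inE Qi sQ andbT; case: eqP.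
  - by move=> Q; rewrite mem_s inE => /and3P[].
  - by rewrite inE.
  - by rewrite inE => /eqP ->.
  - by move=> Q; rewrite mem_s => /and3P[].
  congr ((polyseq _)`_k); rewrite /s big_map big_filter;
    apply: eq_big => [Q | Q].
    by rewrite /cond /monic_irreducible -andbA; congr [&& _, _ & _];
      apply/asboolP/irreducibleP.
  move=> /and3P[Qm /asboolP Qi QP]; apply: eq_bigr => l _.
  have Qmi : monic_irreducible Q by rewrite /monic_irreducible Qm;
    apply/irreducibleP.
  rewrite gr_eltX /e (sg_eq _ (frP Qmi QP)) //
    (monic_irreducible_dvdp P_irr Qmi).
  by rewrite eq_sym.
by apply: eq_bigl => a; rewrite andbT.
Qed.

(** A given sigma_a^-1 occurs as h s with h in Delta exactly when its p-part is s, and then h is its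
    p'-part. *)
Lemma chi_part_theta k s (x : group_ring int gT) : s \in Gam ->
  x = \sum_(a : {poly_k.+1 F} | monic_deg k a && ~~ (P %| a)) gr_elt int (sg
    a)^-1%g ->
  \sum_(h in Delta) (gr_coef x (h * s)%g)%:~R * omega h ^+ i = theta k s.
Proof.
move=> sG ->; rewrite /theta -(@big_npoly_monic _ _ k k.+1 (twist s)) //.
under eq_bigr do rewrite gr_coef_sum rmorph_sum mulr_suml.
rewrite exchange_big /= big_mkcondr; apply: eq_bigr => a _.
rewrite /twist; case: (P %| a) => //=; set g := ((sg a)^-1)%g.
under eq_bigr do rewrite gr_coef_elt.
case: eqP => [gs | gs].
  have gD : (g.`_p^')%g \in Delta by rewrite -p'_elt_Delta p_elt_constt.
  have gE : (g.`_p^' * s = g)%g by rewrite -gs ray_commute consttC.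
  rewrite (bigD1 (g.`_p^')%g) //= gE eqxx mul1r big1 ?addr0 // =>
    h /andP[hD hg].
  have -> : (h * s == g)%g = false; last by rewrite mul0r.
  by apply: contraNF hg => /eqP hE; rewrite -(inj_eq (mulIg s)) hE gE.
rewrite big1 // => h hD; have -> : (h * s == g)%g = false;
  last by rewrite mul0r.
by apply/eqP => hE; apply: gs; apply/ray_decomposition => //; exists h.
Qed.

End EulerFactors.

End WittCharacter.

End RayClassGroup.

(** * The tower of torsion fields *)

(** Vanishing from N on exhibits a polynomial equal to the series, which rules out the default value
    0 of [poly_of_series]. *)
Lemma horner1_poly_of_series (R : nzRingType) (f : nat -> R) (N : nat) :
  (forall k, (N <= k)%N -> f k = 0) ->
  (poly_of_series f).[1] = \sum_(k < N) f k.
Proof.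
move=> f0; have /= H : [set r : {poly R} | forall k, r`_k = f k]%classic
  (poly_of_series f).
  apply: xgetPex; exists (\poly_(k < N) f k) => k /=.
  by rewrite coef_poly; case: ltnP => // /f0.
rewrite (@horner_coef_wide _ N); last by apply/leq_sizeP => k /f0 fk; rewrite H.
by apply: eq_bigr => k _; rewrite expr1n mulr1 H.
Qed.

Section CarlitzTower.
Variables (F : finFieldType) (P : {poly F}) (L : nat -> splittingFieldType
  {fraction {poly F}}).
Variable emb : forall n, 'AHom(L n, L n.+1).
Hypothesis L_tower : is_carlitz_tower L P.

(** L 0 is generated by the roots of Phi_P, and their images are all the roots of Phi_P in L n. *)
Lemma mem_Gamma_torsion n (s : gal_of {:L n}) :
  s \in Gamma emb n <-> forall x, torsion P x -> s x = x.
Proof.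
have [rs split gen] := L_tower 0; rewrite expr1 in split.
pose g := emb0 emb n.
have gP : map_poly g (carlitz_in (L 0) P) = carlitz_in (L n) P.
  rewrite /carlitz_in -map_poly_comp; apply: eq_map_poly => c /=.
  by rewrite rmorph_alg.
have tors x : torsion P x <-> x \in map g rs.
  rewrite /torsion -gP -root_prod_XsubC.
  have : map_poly g (carlitz_in (L 0) P) %= map_poly g (\prod_(x <- rs) ('X -
    x%:P)).
    by rewrite eqp_map.
  move/eqp_root => ->; rewrite rmorph_prod big_map.
  rewrite (eq_bigr (fun x => 'X - (g x)%:P)) // => y _.
  by rewrite rmorphB /= map_polyX map_polyC.
have sE : (s \in Gamma emb n) = kHom (limg g) {:L n} s by apply: gal_kHom;
  exact: subvf.
rewrite sE; split=> [/kAHomP fix_s x /tors /mapP[y yr ->] | fix_s].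
  by apply: fix_s; apply: memv_img; exact: memvf.
apply/kAHomP => x; rewrite -gen aimg_adjoin_seq aimg1 => xr.
apply/fixedSpaceP; move: x xr; apply/subvP/Fadjoin_seqP; split;
  first exact: sub1v.
by move=> x /tors tx; apply/fixedSpaceP; exact: fix_s.
Qed.

End CarlitzTower.

Theorem theorem1p6
  (F : finFieldType) (p d : nat) (P : {poly F})
  (q_ge3 : (3 <= #|F|)%N) (char_p : p \in [pchar F])
  (P_monic : P \is monic) (P_irr : irreducible_poly P)
  (P_deg : size P = d.+1)
  (L : nat -> splittingFieldType {fraction {poly F}})
  (emb : forall n, 'AHom(L n, L n.+1))
  (L_tower : is_carlitz_tower L P)
  (W : comNzRingType) (red : {rmorphism W -> {poly %/ P}})
  (W_witt : is_witt_ring p red)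
  (omega : forall n, gal_of {:L n} -> W)
  (omega_teich : forall n, is_teichmuller p red (omega n))
  (Fr : forall n, {poly F} -> gal_of {:L n})
  (Fr_frob : forall n (Q : {poly F}), Q \is monic -> irreducible_poly Q ->
     Q != P -> is_frobenius Q (Fr n Q))
  (i : nat) (i_ge1 : (1 <= i)%N) (i_le : (i <= #|F| ^ d - 2)%N) :
  ~ pLambda p (Theta_inf emb P p omega Fr i).
Proof.
have Pmi : monic_irreducible P by rewrite /monic_irreducible P_monic;
  apply/irreducibleP.
have d_gt0 : (0 < d)%N by case: P_irr; rewrite P_deg.
have Pd : monic_deg d P by rewrite /monic_deg P_monic P_deg eqxx.
(* Subtraction is truncated; 1 <= i ensures that q^d - 2 is a genuine difference. *)
have i_lt : (i < #|F| ^ d - 1)%N.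
  rewrite ltn_subRL add1n; move: i_le i_ge1; case: i => // i' le _.
  by move: le; rewrite ltn_subRL add2n.
pose j := (#|F| ^ d - 1 - i)%N.
have j_gt0 : (0 < j)%N by rewrite subn_gt0.
have ij : (#|F|.-1 %| i)%N = (#|F|.-1 %| j)%N.
  rewrite -[in LHS](subKn (ltnW i_lt)) dvdn_subr ?leq_subr //.
  by rewrite subn1 dvdn_pred_predX.
case=> y [_ Ty].
(* The degrees k to sum over, with repetition in the even case, where the coefficient of X^l after
   division by 1 - X collects all k <= l. This lets one argument treat both parities. Nothing
   remains from degree d * n.+1 on. *)
pose ks n := if (#|F|.-1 %| i)%N
  then flatten [seq iota 0 l.+1 | l <- iota 0 (d * n.+1)] else iota 0 (d *
    n.+1).
have sum_iota (V : zmodType) (f : nat -> V) N :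
    \sum_(k <- iota 0 N) f k = \sum_(k < N) f k.
  by rewrite -(big_mkord xpredT) /index_iota subn0.
have sum_ks (V : zmodType) (f : nat -> V) n : \sum_(k <- ks n) f k =
    if (#|F|.-1 %| i)%N then \sum_(l < d * n.+1) \sum_(k < l.+1) f k
    else \sum_(k < d * n.+1) f k.
  rewrite /ks; case: ifP => _; last exact: sum_iota.
  rewrite big_flatten big_map sum_iota; apply: eq_bigr => l _; exact: sum_iota.
suff dvdp_ks n : P ^+ n.+1 %| \sum_(k <- ks n) monic_power_sum_coprime P k j.
  have [ji | ji] := boolP (#|F|.-1 %| j)%N.
    have [n /negP[]] := not_dvdp_sum_coprime_even Pd d_gt0 j_gt0 ji.
    by have := dvdp_ks n; rewrite sum_ks ij ji.
  have [n /negP[]] := not_dvdp_sum_coprime_odd Pd d_gt0 j_gt0 ji.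
  by have := dvdp_ks n; rewrite sum_ks ij (negPf ji).
have [rep [[repP repM rep_inj rep_surj] [rep_torsion repFr]]] :=
  carlitz_galois_rep Pmi P_deg (ltn0Sn n) (L_tower n) (Fr_frob n).
(* An inverse of [rep] on classes prime to P, with default value 1 at the multiples of P. *)
have /choice[sg sgP] : forall a, exists g, ~~ (P %| a) -> P ^+ n.+1 %| a - rep
  g.
  move=> a; have [Pa|/rep_surj[g ag]] := boolP (P %| a); last by exists g.
  by exists 1%g.
pose G := 'Gal({:L n} / 1)%G.
have G_full g : g \in G by rewrite gal_kHom ?sub1v // k1AHom.
have mem_Gam g : (g \in Gamma emb n) = (P %| rep g - 1).
  rewrite -opprB dvdpNr;
    apply/idP/idP => [/(mem_Gamma_torsion emb L_tower) gx | Pg].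
    by apply/rep_torsion => x /gx ->;
      rewrite carlitz_inE horner_carlitz_poly carlitz_act1.
  apply/(mem_Gamma_torsion emb L_tower) => x tx.
  by rewrite (proj2 (rep_torsion g 1) Pg x tx) carlitz_inE horner_carlitz_poly
    carlitz_act1.
have omegaP h : h \in 'O_p^'(G)%G -> omega n h ^+ (#|F| ^ d - 1) = 1 /\
    red (omega n h) = in_qpoly P (rep h).
  move=> hD; have := omega_teich n h (rep h) hD (repP h); rewrite P_deg; apply.
  by apply/rep_torsion; rewrite subrr dvdp0.
pose th k := stickelberger_chi P p (Fr n) (fun h =>
  omega n h ^+ i) (Gamma emb n) k.
have thE k s : gr_coef (th k) s = theta p P sg (omega n) i k (sgval s).
  rewrite /gr_coef ffunE.
  apply: (chi_part_theta char_p Pmi (ltn0Sn n) G_full repP repM rep_inj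
    mem_Gam) => //.
    exact: subgP.
  exact: (stickelberger_coef Pmi G_full repP repM rep_inj sgP repFr).
have th0 k : (d * n.+1 <= k)%N -> th k = 0.
  move=> dk; apply/ffunP => s; rewrite [RHS]ffunE; apply: etrans (thE k s) _.
  exact: (theta_eq0 char_p Pmi P_deg (ltn0Sn n) G_full repP repM rep_inj
    mem_Gam sgP
    W_witt omegaP i_ge1 i_lt).
have sharpE : Theta_inf emb P p omega Fr i n = \sum_(k <- ks n) th k.
  rewrite sum_ks /Theta_inf /stickelberger_sharp; case: ifPn => qi;
    last exact: horner1_poly_of_series.
  rewrite (horner1_poly_of_series (N := d * n.+1)) // => k dk.
  apply/ffunP => s; rewrite [RHS]ffunE; apply: etrans (gr_coef_sum _ _ _ s) _.
  under eq_bigr do rewrite thE.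
  exact: (sum_theta_eq0 char_p Pmi P_deg (ltn0Sn n) G_full repP repM rep_inj
    mem_Gam sgP
    W_witt omegaP i_ge1 i_lt _ (leqW dk) qi).
apply: (dvdp_sum_coprime char_p Pmi P_deg (ltn0Sn n) G_full repP repM rep_inj
  mem_Gam sgP
  omegaP i_lt) => s sG.
have -> : \sum_(k <- ks n) theta p P sg (omega n) i k s =
    p%:R * gr_coef (y n) (subg (Gamma emb n) s).
  rewrite -gr_coef_natl -Ty sharpE gr_coef_sum; apply: eq_bigr => k _.
  by rewrite thE subgK.
by apply/(witt_red_ker W_witt); exists (gr_coef (y n) (subg (Gamma emb n) s)).
Qed.
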